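(* Let $G$ be a locally finite graph and $r\ge 3$ an integer. The following are equivalent: (i) $G$ is $r$-locally chordal. (ii) $G$ admits a graph-decomposition into its maximal cliques which $r$-locally induces tree-decompositions. (iii) $G$ admits a canonical graph-decomposition into cliques which $r$-locally induces tree-decompositions. (iv) $G$ admits a graph-decomposition into cliques which $r$-locally induces tree-decompositions.
   Context: All graphs are simple and possibly infinite; locally finite means every vertex has finite degree. $d_G$ denotes graph distance and $N^d[v]$ the set of vertices at distance at most $d$ from $v$. The ball $B_{r/2}(v)$ is the subgraph of $G$ whose vertices are those at distance at most $r/2$ from $v$ and whose edges are the edges of $G$ for which the sum of the distances of the endpoints to $v$ is strictly less than $r$. A graph is chordal if each of its cycles of length at least $4$ has a chord; $G$ is $r$-locally chordal if every ball $B_{r/2}(v)$, $v\in V(G)$, is chordal. A graph-decomposition of $G$ is a pair $(H,\mathcal V)$ of a graph $H$ and a family $\mathcal V=(V_h)_{h\in V(H)}$ of vertex-subsets of $G$ (bags) such that $G=\bigcup_hG[V_h]$ and, for every vertex $v$, $H[W_v]$ is connected, where $W_v=\{h:v\in V_h\}$. It comes with a fixed choice of co-parts $H_v$, each a connected spanning subgraph of $H[W_v]$. It is into cliques if every $V_h$ is a clique of $G$ (empty set allowed), and into the maximal cliques of $G$ if $h\mapsto V_h$ is a bijection from $V(H)$ to the set of inclusion-maximal cliques of $G$. It is canonical if there is an action of $\mathrm{Aut}(G)$ on $H$ (by graph automorphisms) with $\gamma(V_h)=V_{\gamma\cdot h}$ and $\gamma\cdot H_v=H_{\gamma(v)}$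 for all $\gamma\in\mathrm{Aut}(G)$, $h\in V(H)$, $v\in V(G)$. A tree-decomposition is a graph-decomposition whose $H$ is a tree. For a vertex $v$ of $G$ put $H^{v,r}=\bigcup\{H_u:d_G(u,v)<r/2\}$, $V^{v,r}_h=V_h\cap N^{r/2}[v]$ for each node $h$ of $H^{v,r}$, and $\mathcal V^{v,r}=(V_h^{v,r})_h$. To $u\in N^{r/2}[v]$ assign the co-part $H^{v,r}_u=H_u$ if $d_G(u,v)<r/2$ and $H^{v,r}_u=H_u\cap H^{v,r}$ if $d_G(u,v)=r/2$. $(H,\mathcal V)$ $r$-locally induces tree-decompositions if, for every vertex $v$, $(H^{v,r},\mathcal V^{v,r})$ with these co-parts is a tree-decomposition of $B_{r/2}(v)$, i.e. $H^{v,r}$ is a tree, $B_{r/2}(v)$ is the union of its subgraphs induced on the sets $V^{v,r}_h$, and each $H^{v,r}_u$ is a connected spanning subgraph of the subgraph of $H^{v,r}$ induced on $\{h:u\in V_h^{v,r}\}$. *)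

(* Defs.v *)
From mathcomp Require Import all_boot.
From mathcomp Require Import boolp classical_sets functions cardinality.

Set Implicit Arguments.
Unset Strict Implicit.
Unset Printing Implicit Defensive.

Local Open Scope classical_set_scope.
Local Obligation Tactic := idtac.

Record sgraph := SGraph {
  vertex :> Type;
  adj : vertex -> vertex -> Prop;
  adj_sym : forall x y, adj x y -> adj y x;
  adj_irr : forall x, ~ adj x x }.

Definition locally_finite (G : sgraph) : Prop :=
  forall v : G, finite_set [set u | adj v u].

Record subgraph (G : sgraph) := Subgraph {
  vset : set G;
  edge : G -> G -> Prop;
  edge_sym : forall x y, edge x y -> edge y x;
  edge_adj : forall x y, edge x y -> adj x y;
  edge_vset : forall x y, edge x y -> vset x }.

Lemma subgraph_ext (G : sgraph) (K L : subgraph G) :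
  vset K = vset L -> (forall x y, edge K x y <-> edge L x y) -> K = L.
Proof.
case: K => vK eK sK aK wK; case: L => vL eL sL aL wL /= vE eE.
have {}eE : eK = eL by apply/funext => x; apply/funext => y; apply/propext.
by subst; congr Subgraph; apply: Prop_irrelevance.
Qed.

Definition full (G : sgraph) : subgraph G :=
  @Subgraph G setT (@adj G) (@adj_sym G) (fun x y xy => xy) (fun x y _ => I).

Section Subgraphs.
Variable G : sgraph.
Implicit Types (K L : subgraph G) (S : set G).

Definition sg_sub K L : Prop :=
  vset K `<=` vset L /\ forall x y, edge K x y -> edge L x y.

Program Definition induced K S : subgraph G :=
  @Subgraph G (vset K `&` S) (fun x y => [/\ edge K x y, S x & S y]) _ _ _.
Next Obligation. by move=> K S x y [/edge_sym xy Sx Sy]. Qed.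
Next Obligation. by move=> K S x y [/edge_adj]. Qed.
Next Obligation. by move=> K S x y [/edge_vset]. Qed.

Program Definition sg_cap K L : subgraph G :=
  @Subgraph G (vset K `&` vset L) (fun x y => edge K x y /\ edge L x y) _ _ _.
Next Obligation. by move=> K L x y [/edge_sym xy /edge_sym]. Qed.
Next Obligation. by move=> K L x y [/edge_adj]. Qed.
Next Obligation. by move=> K L x y [/edge_vset xK /edge_vset]. Qed.

Program Definition sg_bigcup (J : Type) (D : set J) (F : J -> subgraph G) :
    subgraph G :=
  @Subgraph G (\bigcup_(j in D) vset (F j))
    (fun x y => exists2 j, D j & edge (F j) x y) _ _ _.
Next Obligation. by move=> J D F x y [j Dj /edge_sym]; exists j. Qed.
Next Obligation. by move=> J D F x y [j Dj /edge_adj]. Qed.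
Next Obligation. by move=> J D F x y [j Dj /edge_vset]; exists j. Qed.

End Subgraphs.

Fixpoint walk (T : Type) (e : T -> T -> Prop) (n : nat) (x y : T) : Prop :=
  if n is m.+1 then exists2 z, e x z & walk e m z y else x = y.

(* The empty graph is not connected. *)
Definition connected (G : sgraph) (K : subgraph G) : Prop :=
  vset K !=set0 /\
  forall x y, vset K x -> vset K y -> exists n, walk (edge K) n x y.

Definition connected_spanning (G : sgraph) (K L : subgraph G) : Prop :=
  [/\ sg_sub K L, vset K = vset L & connected K].

(* [ordS] is the cyclic successor on ['I_n]. *)
Definition is_cycle (G : sgraph) (K : subgraph G) (n : nat) (c : 'I_n -> G) :
    Prop :=
  [/\ 3 <= n, injective c & forall i, edge K (c i) (c (ordS i))].

Definition has_chord (G : sgraph) (K : subgraph G) (n : nat) (c : 'I_n -> G) :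
    Prop :=
  exists i j, [/\ edge K (c i) (c j), j <> ordS i & i <> ordS j].

Definition chordal (G : sgraph) (K : subgraph G) : Prop :=
  forall (n : nat) (c : 'I_n -> G), 4 <= n -> is_cycle K c -> has_chord K c.

Definition is_tree (G : sgraph) (K : subgraph G) : Prop :=
  connected K /\ forall (n : nat) (c : 'I_n -> G), ~ is_cycle K c.

Section Balls.
Variable G : sgraph.
Implicit Types (u v w : G) (r : nat).

(* [dist u v n]: the distance of u and v is finite and equal to n. *)
Definition dist u v (n : nat) : Prop :=
  walk (@adj G) n u v /\ forall m, walk (@adj G) m u v -> n <= m.

(* The vertices at distance at most r/2, resp. less than r/2, from v;
   inequalities are doubled since r may be odd. *)
Definition nbhd r v : set G :=
  [set u | exists2 n, dist u v n & n.*2 <= r].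

Definition open_nbhd r v : set G :=
  [set u | exists2 n, dist u v n & n.*2 < r].

Program Definition ball r v : subgraph G :=
  @Subgraph G (nbhd r v)
    (fun x y => [/\ nbhd r v x, nbhd r v y, adj x y &
       exists n m, [/\ dist x v n, dist y v m & n + m < r]]) _ _ _.
Next Obligation.
move=> r v x y [xv yv xy [n [m [xn ym nm]]]]; split=> //; first exact: adj_sym.
by exists m, n; split=> //; rewrite addnC.
Qed.
Next Obligation. by move=> r v x y []. Qed.
Next Obligation. by move=> r v x y []. Qed.

Definition locally_chordal r : Prop := forall v, chordal (ball r v).

Definition clique (K : set G) : Prop :=
  forall x y, K x -> K y -> x <> y -> adj x y.

Definition maximal_clique (K : set G) : Prop :=
  clique K /\ forall K', clique K' -> K `<=` K' -> K' = K.

End Balls.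

(* (L, bag) with co-parts [copart] is a graph-decomposition of K. Here K and L
   are subgraphs of ambient graphs G and H, so that global and local
   decompositions are instances of the same notion; values of [bag] off L and
   of [copart] off K are irrelevant. *)
Definition is_decomposition (G H : sgraph) (K : subgraph G) (L : subgraph H)
    (bag : H -> set G) (copart : G -> subgraph H) : Prop :=
  [/\ forall h, vset L h -> bag h `<=` vset K,
      K = sg_bigcup (vset L) (fun h => induced K (bag h)),
      forall v, vset K v -> connected (induced L [set h | bag h v]) &
      forall v, vset K v ->
        connected_spanning (copart v) (induced L [set h | bag h v])].

Definition is_tree_decomposition (G H : sgraph) (K : subgraph G)
    (L : subgraph H) (bag : H -> set G) (copart : G -> subgraph H) : Prop :=
  is_decomposition K L bag copart /\ is_tree L.

Record graph_decomposition (G : sgraph) := GraphDecomposition {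
  dgraph : sgraph;
  bag : dgraph -> set G;
  copart : G -> subgraph dgraph;
  decompositionP : is_decomposition (full G) (full dgraph) bag copart }.

Section Automorphisms.
Variable G : sgraph.

Record aut := Aut {
  aut_fun :> G -> G;
  aut_bij : bijective aut_fun;
  aut_adj : forall x y, adj (aut_fun x) (aut_fun y) <-> adj x y }.

Definition aut_id : aut :=
  @Aut id (Bijective (fun=> erefl) (fun=> erefl)) (fun x y => iff_refl (adj x y)).

Definition aut_comp (f g : aut) : aut :=
  @Aut (f \o g) (bij_comp (aut_bij f) (aut_bij g))
    (fun x y => iff_trans (aut_adj f (g x) (g y)) (aut_adj g x y)).

Program Definition sg_image (f : aut) (K : subgraph G) : subgraph G :=
  @Subgraph G (f @` vset K)
    (fun x y => exists x' y', [/\ edge K x' y', f x' = x & f y' = y]) _ _ _.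
Next Obligation.
by move=> f K x y [x' [y' [/edge_sym yx fx fy]]]; exists y', x'.
Qed.
Next Obligation.
by move=> f K x y [x' [y' [/edge_adj xy <- <-]]]; apply/aut_adj.
Qed.
Next Obligation.
by move=> f K x y [x' [y' [/edge_vset xK <- _]]]; exists x'.
Qed.

End Automorphisms.

Section Decompositions.
Variables (G : sgraph) (D : graph_decomposition G).

Definition into_cliques : Prop := forall h : dgraph D, clique (bag h).

Definition into_maximal_cliques : Prop :=
  set_bij [set: dgraph D] [set K : set G | maximal_clique K] (@bag G D).

Definition is_canonical : Prop :=
  exists act : aut G -> aut (dgraph D),
    [/\ forall h, act (aut_id G) h = h,
        forall (f g : aut G) h, act (aut_comp f g) h = act f (act g h),
        forall (f : aut G) h, f @` bag h = bag (act f h) &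
        forall (f : aut G) v, sg_image (act f) (copart D v) = copart D (f v)].

Definition local_graph (r : nat) (v : G) : subgraph (dgraph D) :=
  sg_bigcup (open_nbhd r v) (copart D).

Definition local_bag (r : nat) (v : G) (h : dgraph D) : set G :=
  bag h `&` nbhd r v.

Definition local_copart (r : nat) (v u : G) : subgraph (dgraph D) :=
  if `[< open_nbhd r v u >] then copart D u
  else sg_cap (copart D u) (local_graph r v).

Definition locally_induces_tree_decompositions (r : nat) : Prop :=
  forall v : G, is_tree_decomposition (ball r v) (local_graph r v)
    (local_bag r v) (local_copart r v).

End Decompositions.

(* Main.v *)
Require Import Defs.
From mathcomp Require Import all_boot.
From mathcomp Require Import boolp classical_sets functions cardinality.
From mathcomp Require Import zify.

(** Both decompositions that have to be built come from one construction. For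
    every nonempty clique [S] consider the components of the graph induced on
    the common neighbourhood [link S]. A star is put down whose centre is a node
    with a bag containing [S], and which has for each component [C] a leaf whose
    bag contains [S] and meets [C]. Gluing all these stars gives [hub_graph].
    By induction from large to small [S], the nodes whose bags contain a given
    nonempty clique induce a connected subgraph ([hub_holding_conn]). With
    maximal cliques as nodes and arbitrary leaves this is a decomposition into
    the maximal cliques. With all cliques as nodes, [S] as the centre of its own
    star, and as the leaf for [C] the union of [S] and a clique of [C] that is
    invariant under automorphisms ([core]), it is a canonical one.

    Local chordality enters twice. First, for each vertex [u] the nodes holding
    [u] induce a tree ([hub_acyclic]). On a cycle of such nodes, consider an
    edge whose two bags have an inclusion-minimal intersection [S]. The rest of
    the cycle gives walks around [S] in the closed neighbourhood of [u], which
    by chordality can be shortened to walks in [link S] ([reach_link]). Hence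
    the ends of the edge are linked without it among the nodes holding [S], but
    there all edges of the star of [S] are bridges ([spoke_bridge]).

    Second, the trees of the vertices in the open r/2-neighbourhood of [v] form
    a tree together ([meeting_acyclic]). The open neighbourhood is finite,
    connected and chordal, so by Dirac's theorem ([simplicial_exists]) it can be
    built up by adding vertices that are simplicial at that stage. The tree of
    such a vertex meets the union of the previous trees in a connected subgraph,
    and a union of two trees along a connected intersection is a tree
    ([acyclic_union]). A vertex at distance exactly r/2 has a clique as its open
    neighbourhood in the ball ([sphere_simplicial]), which makes its co-part
    connected.

    Conversely, trees in a forest that meet cyclically cannot be disjoint
    crosswise ([four_subtrees]). Applied to the subtrees of the vertices on a
    cycle in a ball this produces a chord ([chordal_ball]). So any decomposition
    into cliques of the required kind forces local chordality, from which both
    special decompositions were built. *)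

Set Implicit Arguments.
Unset Strict Implicit.
Unset Printing Implicit Defensive.

Local Open Scope classical_set_scope.

(** * Walks *)

Section Walks.
Variable T : Type.
Implicit Types (e : T -> T -> Prop) (x y z : T).

Definition reach e x y := exists n, walk e n x y.

Definition symm e := forall x y, e x y -> e y x.

Lemma reach_refl e x : reach e x x.
Proof. by exists 0. Qed.

Lemma reach1 e x y : e x y -> reach e x y.
Proof. by move=> xy; exists 1; exists y. Qed.

Lemma walk_cat e m n x y z :
  walk e m x y -> walk e n y z -> walk e (m + n) x z.
Proof.
elim: m x => [|m IH] x /=; first by move->.
by case=> w xw wy yz; exists w => //; apply: IH.
Qed.

Lemma reach_trans e x y z : reach e x y -> reach e y z -> reach e x z.
Proof. by move=> [m xy] [n yz]; exists (m + n); apply: walk_cat yz. Qed.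

Lemma reach_sym e x y : symm e -> reach e x y -> reach e y x.
Proof.
move=> eS [n]; elim: n x => [|n IH] x /=; first by move->; apply: reach_refl.
by case=> z xz /IH zy; apply: reach_trans zy (reach1 (eS _ _ xz)).
Qed.

Lemma walk_mono e e' n x y :
  (forall a b, e a b -> e' a b) -> walk e n x y -> walk e' n x y.
Proof. by move=> ee'; elim: n x => //= n IH x [z /ee' xz /IH zy]; exists z. Qed.

Lemma reach_mono e e' x y :
  (forall a b, e a b -> e' a b) -> reach e x y -> reach e' x y.
Proof. by move=> ee' [n xy]; exists n; apply: walk_mono xy. Qed.

Lemma reach_stable e (P : set T) x y :
  (forall a b, e a b -> P a -> P b) -> reach e x y -> P x -> P y.
Proof.
move=> eP [n]; elim: n x => [|n IH] x /=; first by move->.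
by case=> z xz zy Px; apply: IH zy (eP _ _ xz Px).
Qed.

Lemma walk_split e (P : T -> T -> Prop) n x y : walk e n x y ->
  walk (fun a b => e a b /\ P a b) n x y \/
  exists k l a b, [/\ walk (fun a b => e a b /\ P a b) k x a,
    e a b, ~ P a b, walk e l b y & l < n].
Proof.
elim: n x => [|n IH] x /=; first by left.
case=> z xz zy; case: (pselect (P x z)) => [Pxz|NP]; last first.
  by right; exists 0, n, x, z.
case: (IH _ zy) => [wz|[k [l [a [b [za ab Pab bl ln]]]]]].
  by left; exists z.
right; exists k.+1, l, a, b; split=> //; last exact: ltnW.
by exists z.
Qed.

Lemma walk_fun e n x y : walk e n x y ->
  exists q : nat -> T,
    [/\ q 0 = x, q n = y & forall i, i < n -> e (q i) (q i.+1)].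
Proof.
elim: n x => [|n IH] x /=; first by move->; exists (fun=> y).
case=> z xz /IH [q [q0 qn qe]].
exists (fun i => if i is j.+1 then q j else x); split=> // -[_|i].
  by rewrite q0.
exact: qe.
Qed.

Lemma fun_walk e n (q : nat -> T) a b :
  (forall i, i < n -> e (q i) (q i.+1)) -> a <= b <= n ->
  walk e (b - a) (q a) (q b).
Proof.
move=> qe /andP[]; elim: b => [|b IH].
  by rewrite leqn0 => /eqP->.
rewrite leq_eqVlt => /orP[/eqP-> _|ab bn]; first by rewrite subnn.
rewrite subSn // -addn1; apply: walk_cat (IH ab (ltnW bn)) _.
by exists (q b.+1) => //; apply: qe.
Qed.

Lemma shortest_walk e x y : reach e x y ->
  exists m (q : nat -> T), [/\ q 0 = x, q m = y,
    forall i, i < m -> e (q i) (q i.+1),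
    forall i j, i < j <= m -> q i <> q j &
    forall i j, i.+1 < j <= m -> ~ e (q i) (q j)].
Proof.
move=> [n0 w0]; have ex : exists n, `[< walk e n x y >].
  by exists n0; apply/asboolP.
case: (ex_minnP ex) => m /asboolP wm minm.
have [q [q0 qm qe]] := walk_fun wm.
exists m, q; split=> // i j /andP[ij jm].
  move=> qij; have /asboolP/minm : walk e (i + (m - j)) x y.
    apply: (@walk_cat _ _ _ _ (q i)).
      by rewrite -q0 -{1}(subn0 i); apply: fun_walk qe _; lia.
    by rewrite qij -qm; apply: fun_walk qe _; lia.
  lia.
move=> eij; have /asboolP/minm : walk e (i + (1 + (m - j))) x y.
  apply: (@walk_cat _ _ _ _ (q i)).
    by rewrite -q0 -{1}(subn0 i); apply: fun_walk qe _; lia.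
  apply: (@walk_cat _ _ _ _ (q j)); first by exists (q j).
  by rewrite -qm; apply: fun_walk qe _; lia.
lia.
Qed.

End Walks.

(** * Forests *)

Section Acyclic.
Variable T : Type.
Implicit Types (e : T -> T -> Prop) (x y z : T) (A B C D : set T).

Definition del e x y a b := [/\ e a b, ~ (a = x /\ b = y) & ~ (a = y /\ b = x)].

(** Cycle-freeness in the form in which it gets used: every edge is a bridge. *)
Definition acyclic e := forall x y, e x y -> ~ reach (del e x y) x y.

Definition within e A x y := [/\ A x, A y & e x y].

Definition conn e A := forall x y, A x -> A y -> reach (within e A) x y.

Lemma del_sym e x y : symm e -> symm (del e x y).
Proof. by move=> eS a b [ab ? ?]; split; [exact: eS|tauto|tauto]. Qed.

Lemma within_sym e A : symm e -> symm (within e A).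
Proof. by move=> eS a b [Aa Ab ab]; split=> //; apply: eS. Qed.

Lemma within_mono e A B x y : A `<=` B ->
  reach (within e A) x y -> reach (within e B) x y.
Proof. by move=> AB; apply: reach_mono => a b [/AB ? /AB]. Qed.

Lemma last_exit e A x y : reach e x y -> A x -> ~ A y ->
  exists a b, [/\ A a, ~ A b, e a b & reach (within e (~` A)) b y].
Proof.
move=> [n xy] Ax NAy.
have:  (~ A x /\ reach (within e (~` A)) x y) \/
    exists a b, [/\ A a, ~ A b, e a b & reach (within e (~` A)) b y].
  elim: n x {Ax} xy => [|n IH] x /=.
    by move->; left; split=> //; apply: reach_refl.
  case=> z xz /IH [[NAz zy]|]; last by right.
  case: (pselect (A x)) => Ax; first by right; exists x, z.
  by left; split=> //; apply: reach_trans zy; apply: reach1.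
by case=> // -[/(_ Ax)].
Qed.

(** If the cyclically meeting sets had [A], [C] disjoint and [B], [D] disjoint,
    then the edge by which a walk in [B] leaves [A] for good would not be a
    bridge: its ends are joined through the rest of [B], then [C], [D], [A]. *)
Lemma four_subtrees e A B C D : symm e -> acyclic e ->
  conn e A -> conn e B -> conn e C -> conn e D ->
  A `&` B !=set0 -> B `&` C !=set0 -> C `&` D !=set0 -> D `&` A !=set0 ->
  A `&` C !=set0 \/ B `&` D !=set0.
Proof.
move=> eS eA cA cB cC cD [ab [Aab Bab]] [bc [Bbc Cbc]] [cd [Ccd Dcd]]
  [da [Dda Ada]].
apply: contrapT => /not_orP[NAC NBD].
have dAC x : A x -> C x -> False by move=> ? ?; apply: NAC; exists x.
have dBD x : B x -> D x -> False by move=> ? ?; apply: NBD; exists x.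
have [x [y [Ax NAy [Bx By xy] ybc]]] :=
  last_exit (cB _ _ Bab Bbc) Aab (fun Abc => dAC _ Abc Cbc).
apply: (eA _ _ xy); apply: reach_sym; first exact: del_sym.
have sub E a b : (E x -> E y -> False) ->
    reach (within e E) a b -> reach (del e x y) a b.
  move=> nE; apply: reach_mono => u w [Eu Ew uw].
  by split=> // -[? ?]; subst; apply: nE.
apply: reach_trans (sub A _ _ _ (cA _ _ Ada Ax)); last by move=> _ /NAy.
apply: reach_trans (sub D _ _ _ (cD _ _ Dcd Dda)); last by move=> /(dBD _ Bx).
apply: reach_trans (sub C _ _ _ (cC _ _ Cbc Ccd)); last by move=> /(dAC _ Ax).
apply: (sub (~` A)); first by move=> /(_ Ax).
by apply: reach_mono ybc => a b [? ? []].
Qed.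

(** Deleting an edge of a connected subgraph [I] leaves at most two pieces of
    [I], one at each end; a forest around [I] cannot rejoin them. *)
Lemma reach_sub_forest (e i : T -> T -> Prop) (I : set T) x y p q :
  symm e -> acyclic e -> symm i -> (forall a b, i a b -> e a b) ->
  (forall a b, i a b -> I a) ->
  (forall a b, I a -> I b -> reach i a b) -> I p -> I q ->
  reach (del e x y) p q -> reach (del i x y) p q.
Proof.
move=> eS eA iS ie iI iC Ip Iq pq.
case: (pselect (i x y)) => [ixy|nixy]; last first.
  apply: reach_mono (iC _ _ Ip Iq) => a b ab.
  by split=> // -[? ?]; subst; [|move/iS in ab].
have diS : symm (del i x y) by apply: del_sym.
have ends z n w : walk i n z w -> (w = x \/ w = y) ->
    reach (del i x y) z x \/ reach (del i x y) z y.
  elim: n z => [|n IH] z /=.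
    by move=> -> [->|->]; [left|right]; apply: reach_refl.
  case=> z' zz' /IH {}IH /IH {}IH.
  case: (pselect (z = x)) => [->|zx]; first by left; apply: reach_refl.
  case: (pselect (z = y)) => [->|zy]; first by right; apply: reach_refl.
  have dzz : del i x y z z' by split=> // -[].
  by case: IH => IH; [left|right]; apply: reach_trans IH; apply: reach1.

have end_ z : I z -> reach (del i x y) z x \/ reach (del i x y) z y.
  by move=> Iz; have [n zx] := iC _ _ Iz (iI _ _ ixy); apply: ends zx _; left.
have up a b : reach (del i x y) a b -> reach (del e x y) a b.
  by apply: reach_mono => u w [/ie ? ? ?].
have deS : symm (del e x y) by apply: del_sym.
case: (end_ p Ip) => px; case: (end_ q Iq) => qx.
- by apply: reach_trans px _; apply: reach_sym.
- case: (eA _ _ (ie _ _ ixy)); apply: reach_trans (up _ _ qx).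
  by apply: reach_trans pq; apply/reach_sym/up.
- case: (eA _ _ (ie _ _ ixy)); apply: reach_sym => //.
  apply: reach_trans (up _ _ qx).
  by apply: reach_trans pq; apply/reach_sym/up.
- by apply: reach_trans px _; apply: reach_sym.
Qed.

Section Union.
Variables (e f : T -> T -> Prop) (V W : set T).
Hypotheses (eS : symm e) (fS : symm f) (eA : acyclic e) (fA : acyclic f).
Hypotheses (eV : forall a b, e a b -> V a) (fW : forall a b, f a b -> W a).
Hypothesis cap_conn : forall a b, V a -> W a -> V b -> W b ->
  reach (fun x y => e x y /\ f x y) a b.

(** Excursions of a walk into [f] start and end in the intersection, where
    they can be replaced by walks of [e]. *)
Lemma reach_union x y a b : V a -> V b ->
  reach (del (fun a b => e a b \/ f a b) x y) a b -> reach (del e x y) a b.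
Proof.
move=> Va Vb [n]; pose i a b := e a b /\ f a b.
have iS : symm i by move=> u w [/eS ? /fS].
have exc p q : V p -> W p -> V q -> W q -> reach (del f x y) p q ->
    reach (del e x y) p q.
  move=> Vp Wp Vq Wq pq.
  have : reach (del i x y) p q.
    apply: (@reach_sub_forest f i (V `&` W)) => //.
    - by move=> u w [].
    - by move=> u w [/eV ? /fW].
    - by move=> u w [? ?] [? ?]; apply: cap_conn.
  by apply: reach_mono => u w [[]].
suff H : forall n a, walk (del (fun a b => e a b \/ f a b) x y) n a b ->
    (V a -> reach (del e x y) a b) /\
    (W a -> exists p, [/\ V p, W p, reach (del f x y) a p &
                           reach (del e x y) p b]).
  by move=> /H [/(_ Va)].
elim=> [|{}n IH] {Va}a /=.
  move->; split=> [_|Wb]; first exact: reach_refl.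
  by exists b; split=> //; apply: reach_refl.
case=> c [[ac|ac] n1 n2] /IH[IHe IHf].
  have ab : reach (del e x y) a b.
    by apply: reach_trans (IHe (eV (eS ac))); apply: reach1; split.
  split=> // Wa; exists a; split=> //; [exact: eV ac|exact: reach_refl].
have [p [Vp Wp cp pb]] := IHf (fW (fS ac)).
have ap : reach (del f x y) a p by apply: reach_trans cp; apply: reach1; split.
split=> [Va|Wa]; last by exists p.
by apply: reach_trans pb; apply: exc => //; apply: fW ac.
Qed.

End Union.

Lemma acyclic_union (e f : T -> T -> Prop) (V W : set T) :
  symm e -> symm f -> acyclic e -> acyclic f ->
  (forall a b, e a b -> V a) -> (forall a b, f a b -> W a) ->
  (forall a b, V a -> W a -> V b -> W b ->
    reach (fun x y => e x y /\ f x y) a b) ->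
  acyclic (fun a b => e a b \/ f a b).
Proof.
move=> eS fS eA fA eV fW cap x y [xy|xy] R.
  apply: (eA _ _ xy).
  apply: (reach_union eS fS fA eV fW cap) R; first exact: eV xy.
  exact: eV (eS _ _ xy).
apply: (fA _ _ xy).
apply: (@reach_union _ _ _ _ fS eS eA fW eV _ x y); rewrite ?(fW _ _ xy) //.
- move=> a b Wa Va Wb Vb; apply: reach_mono (cap a b Va Wa Vb Wb) => u w.
  by case.
- exact: fW xy.
- exact: fW (fS _ _ xy).
- by apply: reach_mono R => u w [uw ? ?]; split=> //; case: uw; [right|left].
Qed.

Lemma acyclic_sub (e f : T -> T -> Prop) :
  (forall x y, e x y -> f x y) -> acyclic f -> acyclic e.
Proof.
move=> ef fA x y /ef /fA nR R; apply: nR.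
by apply: reach_mono R => a b [/ef].
Qed.

End Acyclic.

Section Cycles.
Variables (G : sgraph) (K : subgraph G).

Lemma val_ordS n (i : 'I_n) : ordS i = (if i.+1 == n then 0 else i.+1) :> nat.
Proof.
case: eqP => /= [->|/eqP ni]; first by rewrite modnn.
by rewrite modn_small // ltn_neqAle ni ltn_ord.
Qed.

Lemma cycle_walk n (c : 'I_n -> G) (i : 'I_n) :
  walk (fun a b => exists j, [/\ j <> i, a = c j & b = c (ordS j)])
    n.-1 (c (ordS i)) (c i).
Proof.
have n0 : 0 < n by case: n {c} i => // -[].
pose o k : 'I_n := Ordinal (ltn_pmod (i.+1 + k) n0).
pose q k := c (o k).
have oS k : ordS (o k) = o k.+1.
  by apply: val_inj; rewrite /= -[X in X %% n = _]addn1 modnDml addn1 addnS.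
have q0 : q 0 = c (ordS i) by congr c; apply: val_inj; rewrite /= addn0.
have qn : q n.-1 = c i.
  congr c; apply: val_inj; rewrite /= addSnnS prednK // modnDr.
  by rewrite modn_small.
rewrite -q0 -qn -{1}(subn0 n.-1).
apply: (@fun_walk _ _ n.-1) => [k kn|]; last by rewrite leqnn.
exists (o k); split=> //; last by rewrite oS.
move=> /(congr1 val) /= E; have : i.+1 + k <= i + n by lia.
move: E; case: (ltnP (i.+1 + k) n) => ikn; first by rewrite modn_small //; lia.
have -> : i.+1 + k = (i.+1 + k - n) + n by lia.
have lin := ltn_ord i; rewrite modnDr modn_small; lia.
Qed.

Lemma cycle_del n (c : 'I_n -> G) i j : is_cycle K c -> j <> i ->
  del (edge K) (c (ordS i)) (c i) (c j) (c (ordS j)).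
Proof.
move=> [n3 cI cE] ji; split; first exact: cE.
  move=> [/cI ij /cI ji']; move: (congr1 (@nat_of_ord n) ij).
  move: (congr1 (@nat_of_ord n) ji'); rewrite !val_ordS.
  by have := ltn_ord i; have := ltn_ord j; do 2!case: eqP; lia.
by move=> [/cI].
Qed.

Lemma acyclicP :
  acyclic (edge K) <-> forall (n : nat) (c : 'I_n -> G), ~ is_cycle K c.
Proof.
split=> [A n c cK|N x y xy R].
  have [n3 cI cE] := cK; have n0 : 0 < n by lia.
  pose i := Ordinal n0.
  apply: (A (c (ordS i)) (c i)); first by apply: edge_sym.
  exists n.-1; apply: walk_mono (cycle_walk c i) => a b [j [ji -> ->]].
  exact: cycle_del.
have exy : del (edge K) x y x y -> False by case=> _ /(_ (conj erefl erefl)).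
have [m [q [q0 qm qE qI _]]] := shortest_walk R.
have m1 : 1 < m.
  case: m {qI} qm qE => [|[|//]] qm qE; last first.
    by case: exy; move: (qE 0 isT); rewrite q0 qm.
  by move/edge_adj: xy; rewrite -q0 qm => /adj_irr.
have qM i j : i <= m -> j <= m -> q i = q j -> i = j.
  move=> im jm qij; case: (ltngtP i j) => // ij.
    by case: (qI i j _ qij); rewrite ij.
  by case: (qI j i _ (esym qij)); rewrite ij.
apply: (N m.+1 (fun i => q i)); split=> //.
  by move=> i j qij; apply: ord_inj; apply: qM; rewrite // -ltnS ltn_ord.
move=> i; rewrite val_ordS; case: eqP => [[im]|im].
  by rewrite im qm q0; apply: edge_sym.
have /qE [] // : i < m by have := ltn_ord i; lia.
Qed.
End Cycles.

(** * Finite families of sets *)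

Section FiniteSets.
Variable T : Type.
Implicit Types (P : set T -> Prop) (A B M : set T).

Lemma finite_proper_ind P :
  (forall A, finite_set A -> (forall B, B `<` A -> P B) -> P A) ->
  forall A, finite_set A -> P A.
Proof.
move=> IH A fA; have [n /card_set_bijP[f [fI finj _]]] := fA.
pose mu B := #|[set k : 'I_n | `[< exists2 x, B x & f x = k >]]%SET|.
have [m] := ubnP (mu A); have : A `<=` A by [].
elim: m {-2}A => [|m IHm] B BA //; rewrite ltnS => Bm.
apply: IH; first exact: sub_finite_set fA.
move=> C [CB NBC]; apply: IHm; first exact: subset_trans BA.
apply: leq_trans Bm; apply: proper_card; apply/properP; split.
  apply/fintype.subsetP => k; rewrite !inE => -[x Cx fx].
  by exists x => //; apply: CB.
move/existsNP: NBC => [x /not_implyP[Bx NCx]].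
exists (Ordinal (fI _ (BA _ Bx))); rewrite !inE; first by exists x.
apply/asboolPn => -[y Cy /= fxy]; apply: NCx; suff -> : x = y by [].
by apply: finj; rewrite ?inE //; [exact: BA|exact/BA/CB].
Qed.

Lemma finite_superset_ind P M : finite_set M ->
  (forall A, A `<=` M -> (forall B, A `<` B -> B `<=` M -> P B) -> P A) ->
  forall A, A `<=` M -> P A.
Proof.
move=> fM IH A AM.
suff H B : finite_set B -> forall A, A `<=` M -> B = M `\` A -> P A.
  by apply: (H (M `\` A)) => //; apply: sub_finite_set fM; apply: subDsetl.
move=> fB; elim/finite_proper_ind: B / fB => B _ IHB {AM}A AM BE.
apply: IH => // C [AC NCA] CM; apply: (IHB (M `\` C) _ C CM erefl); rewrite BE.
split; first by move=> x [Mx NCx]; split=> // /AC.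
by move=> sub; apply: NCA => x Cx; apply: contrapT => NAx;
  have [] := sub x (conj (CM _ Cx) NAx).
Qed.

Lemma finite_maximal P M A : finite_set M ->
  (forall B, P B -> B `<=` M) -> P A ->
  exists B, [/\ P B, A `<=` B & forall C, P C -> B `<=` C -> C = B].
Proof.
move=> fM PM PA; move: (PM _ PA) => AM; move: A AM PA.
apply: (finite_superset_ind fM) => A AM IH PA.
case: (pselect (exists2 C, A `<` C & P C)) => [[C AC PC]|N].
  have [B [PB CB Bmax]] := IH _ AC (PM _ PC) PC; exists B; split=> //.
  by apply: subset_trans CB; case: AC.
exists A; split=> // C PC AC; rewrite eqEsubset; split=> //.
by apply: contrapT => NCA; apply: N; exists C.
Qed.

Lemma finite_family_minimal n (F : 'I_n -> set T) (i0 : 'I_n) :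
  exists i, forall j, ~ (F j `<` F i).
Proof.
pose m i := #|[set j : 'I_n | `[< F j `<` F i >]]%SET|.
have [i _ imin] := @arg_minnP _ i0 xpredT m isT.
exists i => j [ji Nij]; have := imin j isT; rewrite leqNgt => /negP; apply.
apply: proper_card; apply/properP; split.
  apply/fintype.subsetP => k; rewrite !inE => -[kj Njk]; split.
    exact: subset_trans ji.
  by move=> ik; apply: Njk; apply: subset_trans ik.
by exists j; rewrite !inE //; apply/asboolPn => -[_]; apply.
Qed.

End FiniteSets.

(** * Chordal vertex sets, simplicial vertices and links of cliques *)

Section ChordalSets.
Variable G : sgraph.
Implicit Types (U A B C S Q : set G) (a b c d x y : G).

(** Chordality of the subgraph induced on [U], in the form in which it gets
    used: if two vertices [a], [b] with a common neighbour [d] are joined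
    through a connected set [A] that does not touch [d], then a shortest walk
    from [a] to [b] through [A] closes up with [d] to a cycle whose only
    possible chord joins [a] and [b]. *)
Definition chordal_on U := forall A a b d, A `<=` U -> U a -> U b -> U d ->
  conn (@adj G) A -> (exists2 x, A x & adj a x) -> (exists2 x, A x & adj b x) ->
  adj d a -> adj d b -> (forall x, A x -> x <> d /\ ~ adj x d) ->
  a <> b -> adj a b.

Lemma chordal_on_sub U U' : U' `<=` U -> chordal_on U -> chordal_on U'.
Proof.
move=> UU' cU A a b d AU Ua Ub Ud; apply: cU; try exact: UU'.
exact: subset_trans UU'.
Qed.

Lemma chordal_chordal_on (K : subgraph G) U : chordal K ->
  (forall x y, U x -> U y -> adj x y -> edge K x y) -> chordal_on U.
Proof.
move=> cK UK A a b d AU Ua Ub Ud cA [a' Aa' aa'] [b' Ab' bb'] da db Ad nab.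
apply: contrapT => Nab.
have [m [q [q0 qm qE qI qC]]] :
    exists m (q : nat -> G), [/\ q 0 = a, q m = b,
      forall i, i < m -> within (@adj G) (A `|` [set a; b]) (q i) (q i.+1),
      forall i j, i < j <= m -> q i <> q j &
      forall i j, i.+1 < j <= m ->
        ~ within (@adj G) (A `|` [set a; b]) (q i) (q j)].
  apply: shortest_walk.
  apply: reach_trans (_ : reach _ a a') _.
    by apply: reach1; split=> //; [right; left|left].
  apply: reach_trans (_ : reach _ a' b') _.
    by apply: within_mono (cA _ _ Aa' Ab'); left.
  by apply: reach1; split; [left|right; right|apply: adj_sym].
have m1 : 1 < m.
  case: m {qI qC} qm qE => [|[|//]] qm qE; last first.
    by case: Nab; case: (qE 0 isT); rewrite q0 qm.
  by case: nab; rewrite -q0 qm.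
have qAB i : i <= m -> (A `|` [set a; b]) (q i).
  rewrite leq_eqVlt => /orP[/eqP->|/qE[] //]; rewrite qm; right; by right.
have qA i : 0 < i < m -> A (q i).
  move=> /andP[i0 im]; case: (qAB i (ltnW im)) => // -[] /= qi.
    by case: (qI 0 i); rewrite ?i0 1?ltnW // q0.
  by case: (qI i m); rewrite ?im ?leqnn // qm.
have qU i : i <= m -> U (q i) by move=> /qAB [/AU|[->|->]].
have qd i : i <= m -> q i <> d.
  move=> /qAB [/Ad[]//|[->|->]] E; subst.
    exact: adj_irr da.
  exact: adj_irr db.
pose c (i : 'I_m.+2) := if i <= m then q i else d.
have qinj i j : i <= m -> j <= m -> q i = q j -> i = j.
  move=> im jm qij; case: (ltngtP i j) => // ij.
    by case: (qI i j _ qij); rewrite ij.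
  by case: (qI j i _ (esym qij)); rewrite ij.
have cinj : injective c.
  move=> i j; rewrite /c => E; apply: ord_inj; move: E.
  have := ltn_ord i; have := ltn_ord j.
  case: ifP => im; case: ifP => jm jm2 im2.
  - exact: qinj.
  - by move/(qd _ im).
  - by move/esym/(qd _ jm).
  - by move=> _; lia.
have cE i : edge K (c i) (c (ordS i)).
  rewrite /c val_ordS; have := ltn_ord i => im2.
  case: eqP => [[iE]|iE]; rewrite ?leq0n ?iE ?ltnn.
    by rewrite q0; apply: UK.
  case: (ltnP i m) => im.
    rewrite ltnW //; apply: UK; [by apply: qU; lia..|].
    by case: (qE i im).
  have -> : (i : nat) = m by lia.
  by rewrite leqnn qm; apply: UK => //; apply: adj_sym.
have [i [j [ij ji ji']]] := cK m.+2 c m1 (And3 (ltnW m1) cinj cE).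
have NS (k l : 'I_m.+2) : k <> ordS l ->
    k <> (if l.+1 == m.+2 then 0 else l.+1) :> nat.
  by move=> kl; rewrite -val_ordS => /ord_inj.
move: (NS _ _ ji) (NS _ _ ji') => {NS ji ji'}.
have qq k l : k <= m -> l <= m -> k <> l.+1 -> l <> k.+1 ->
    edge K (q k) (q l) -> False.
  move=> km lm kl lk e; case: (ltngtP k l) => kl'.
  - apply: (qC k l); first by lia.
    by split; [exact: qAB|exact: qAB|exact: edge_adj e].
  - apply: (qC l k); first by lia.
    by split; [exact: qAB|exact: qAB|apply: adj_sym; exact: edge_adj e].
  - by move: e; rewrite kl' => /edge_adj/adj_irr.
have qqd k : k <= m -> k <> 0 -> k <> m -> adj (q k) d -> False.
  move=> km k0 km'; have /Ad[_] // : A (q k) by apply: qA; lia.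
move: ij; rewrite /c; have := ltn_ord i; have := ltn_ord j.
case: ifP => im; case: ifP => jm jm2 im2 e.
- by do 2!(case: eqP => [|_]; first by lia); move=> ? ?; apply: qq e.
- by move/edge_adj: e => /qqd H; do 2!case: eqP; intros; apply: H; lia.
- by move/edge_adj/adj_sym: e => /qqd H; do 2!case: eqP; intros; apply: H; lia.
- by move/edge_adj/adj_irr: e.
Qed.

End ChordalSets.

Section Simplicial.
Variable G : sgraph.
Implicit Types (U A B C S Q : set G) (a b c d x y : G).

Definition nbrs U x := [set y | U y /\ adj x y].

Definition simplicial U x := clique (nbrs U x).

Lemma adj_in_sym A : symm (within (@adj G) A).
Proof. exact/within_sym/adj_sym. Qed.

Lemma within1 A x y : A x -> A y -> adj x y -> reach (within (@adj G) A) x y.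
Proof. by move=> *; apply: reach1. Qed.

(** Dirac's theorem. For non-adjacent vertices to exist, take a maximal
    connected set [A] such that some vertices, forming a set [D], neither lie in
    nor touch [A]. By maximality the neighbours of [A] outside [A] are complete
    to [D], and by chordality they are pairwise adjacent. So a simplicial vertex
    of the smaller set [D] is simplicial in [U]. *)
Lemma simplicial_exists U : finite_set U -> U !=set0 -> chordal_on U ->
  exists2 x, U x & simplicial U x.
Proof.
move=> fU; elim/finite_proper_ind: U / fU => U fU IH [u Uu] cU.
case: (pselect (clique U)) => [clU|].
  by exists u => // x y [Ux _] [Uy _]; apply: clU.
move=> /existsNP[v /existsNP[w /not_implyP[Uv /not_implyP[Uw
  /not_implyP[vw Nvw]]]]].
pose far A := [set d | [/\ U d, ~ A d & forall x, A x -> ~ adj x d]].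
pose P A := [/\ A `<=` U, A !=set0, conn (@adj G) A & far A !=set0].
have Pv : P [set v].
  split; [by move=> _ ->|by exists v| |].
    by move=> _ _ -> ->; apply: reach_refl.
  by exists w; split=> //; [exact/nesym|move=> _ ->].
have [A [[AU [a0 Aa0] cA [d0 farA]] _ Amax]] :=
  finite_maximal fU (fun B (PB : P B) => let: And4 h _ _ _ := PB in h) Pv.
have near n d : U n -> ~ far A n -> ~ A n -> far A d -> adj n d.
  move=> Un Nfn NAn [Ud NAd Nd].
  have [x Ax xn] : exists2 x, A x & adj x n.
    apply: contrapT => N; apply: Nfn; split=> // x Ax xn.
    by apply: N; exists x.
  have nd : n <> d by move=> E; subst d; apply: Nd Ax xn.
  apply: contrapT => Nnd; apply: NAn.
  suff <- : A `|` [set n] = A by right.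
  apply: Amax; last by left.
  split; first by move=> y [/AU|->].
  - by exists a0; left.
  - have cx y : (A `|` [set n]) y ->
        reach (within (@adj G) (A `|` [set n])) x y.
      move=> [Ay|->]; last by apply: within1; [left|right|].
      by apply: within_mono (cA _ _ Ax Ay); left.
    move=> y z /cx xy /cx; apply: reach_trans; apply: reach_sym xy.
    exact: adj_in_sym.
  - exists d; split=> //; first by case=> // /esym.
    by move=> y [/Nd|->].
have [|||x [Ux NAx Nx] sx] := IH (far A).
- split; first by move=> d [].
  by move=> /(_ _ (AU _ Aa0))[_ /(_ Aa0)].
- by exists d0.
- by apply: chordal_on_sub cU => d [].
exists x => // a b [Ua xa] [Ub xb] ab.
have NA y : adj x y -> ~ A y by move=> xy /Nx; apply; apply: adj_sym.
case: (pselect (far A a)) => fa; case: (pselect (far A b)) => fb.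
- exact: sx.
- by apply/adj_sym/near => //; apply: NA.
- by apply: near => //; apply: NA.
have touch y : U y -> ~ far A y -> ~ A y -> exists2 x, A x & adj y x.
  move=> Uy Nf NAy; apply: contrapT => N; apply: Nf; split=> // z Az zy.
  by apply: N; exists z => //; apply: adj_sym.
apply: (cU A a b x) => //.
- by apply: touch => //; apply: NA.
- by apply: touch => //; apply: NA.
- by move=> y Ay; split; [move=> E; subst y|exact: Nx].
Qed.

Lemma conn_clique A : conn (@adj G) A -> (forall x, A x -> simplicial A x) ->
  clique A.
Proof.
move=> cA sA x y Ax Ay; have [n] := cA _ _ Ax Ay.
elim: n x Ax => [|n IH] x Ax /=; first by move=> ->.
case=> z [_ Az xz] zy xy; case: (pselect (z = y)) => [<-//|zNy].
by apply: (sA z) => //; split=> //; [exact: adj_sym|exact: IH].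
Qed.

(** A walk bypasses a simplicial vertex, whose neighbours on it are equal or
    adjacent. *)
Lemma conn_peel A B : conn (@adj G) A -> B `<=` A ->
  (forall x, A x -> ~ B x -> simplicial A x) -> conn (@adj G) B.
Proof.
move=> cA BA sA x y Bx By; have [n] := cA _ _ (BA _ Bx) (BA _ By).
have [m] := ubnP n; elim: m n x Bx => // m IH [|n] x Bx /=.
  by move=> _ ->; apply: reach_refl.
move=> nm [z [Ax Az xz]] zy.
case: (pselect (B z)) => Bz.
  by apply: reach_trans (within1 Bx Bz xz) (IH n _ Bz _ zy).
case: n nm zy => [|n] nm /=; first by move=> zy; subst z.
case=> w [_ Aw zw] wy; case: (pselect (x = w)) => [E|xw].
  by subst w; apply: IH wy => //; apply: ltnW.
apply: (IH n.+1) => //; exists w => //; split=> //.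
by apply: (sA z) => //; split=> //; apply: adj_sym.
Qed.

Definition peel A := [set x | A x /\ ~ simplicial A x].

(** A clique attached to a finite connected chordal graph in a way that every
    automorphism preserves: remove all simplicial vertices at once, repeatedly,
    and keep the last nonempty stage. *)
Definition core A :=
  [set x | exists n, iter n peel A x /\ iter n.+1 peel A = set0].

(** By Dirac's theorem the process ends; at the last stage all vertices are
    simplicial, and a connected graph with this property is complete. *)
Lemma core_clique A : finite_set A -> A !=set0 -> conn (@adj G) A ->
  chordal_on A -> [/\ core A `<=` A, core A !=set0 & clique (core A)].
Proof.
move=> fA; elim/finite_proper_ind: A / fA => A fA IH A0 cA chA.
have peelA : peel A `<=` A by move=> x [].
case: (pselect (peel A !=set0)) => [B0|]; last first.
  move=> /set0P/negP/negPn/eqP pA.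
  suff -> : core A = A.
    split=> //; apply: conn_clique => // x Ax; apply: contrapT => Nx.
    by have : peel A x by []; rewrite pA.
  apply/seteqP; split=> [x [[|n] []] //|x Ax]; last by exists 0.
  by rewrite iterSr pA => px _; elim: n px => [|n IHn] //= [/IHn].
have iS k : iter k.+1 peel A = iter k peel (peel A) by rewrite iterSr.
have -> : core A = core (peel A).
  apply/seteqP; split=> x [n [nx nE]]; last first.
    by exists n.+1; rewrite (iS n) (iS n.+1).
  case: n nx nE => [|n]; last by rewrite (iS n) (iS n.+1); exists n.
  by move=> _ /= pA; move: B0; rewrite pA => -[].
have [||||sub ne cl] := IH (peel A) => //.
- have [x Ax sx] := simplicial_exists fA A0 chA.
  by split=> // /(_ _ Ax)[].
- apply: conn_peel cA _ _ => // x Ax NBx; apply: contrapT => Nx.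
  exact: NBx.
- exact: chordal_on_sub chA.
by split=> //; apply: subset_trans peelA.
Qed.

Definition link S := [set c | forall s, S s -> adj s c].

Definition link_comp S c := [set d | reach (within (@adj G) (link S)) c d].

Lemma link_comp_eq S c d : link_comp S c d -> link_comp S c = link_comp S d.
Proof.
move=> cd; apply/seteqP; split=> x.
  by apply: reach_trans; apply: reach_sym cd; apply: adj_in_sym.
exact: reach_trans.
Qed.

Lemma link_comp_sub S c d : link S c -> link_comp S c d -> link S d.
Proof. by move=> Lc cd; apply: (reach_stable _ cd Lc) => a b []. Qed.

Lemma conn_link_comp S c : link S c -> conn (@adj G) (link_comp S c).
Proof.
move=> Lc.
suff H d : link_comp S c d -> reach (within (@adj G) (link_comp S c)) c d.
  move=> x y /H cx /H cy; apply: reach_trans cy; apply: reach_sym cx.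
  exact: adj_in_sym.
move=> cd.
suff [] : link_comp S c d /\ reach (within (@adj G) (link_comp S c)) c d by [].
apply: (reach_stable (P := fun d =>
  link_comp S c d /\ reach (within (@adj G) (link_comp S c)) c d) _ cd);
  last first.
  by split; apply: reach_refl.
move=> a b [La Lb ab] [ca ra].
have cb : link_comp S c b by apply: reach_trans ca _; apply: reach1.
by split=> //; apply: reach_trans ra _; apply: within1.
Qed.

Lemma clique_link_comp S Q c d : clique Q -> Q c -> Q d ->
  link S c -> link S d -> link_comp S c = link_comp S d.
Proof.
move=> cQ Qc Qd Lc Ld; case: (pselect (c = d)) => [->//|cd].
by apply: link_comp_eq; apply: within1 => //; apply: cQ.
Qed.

(** In a chordal graph, a walk around [S] between vertices complete to [S] can
    be shortened until it stays within the vertices complete to [S]: a section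
    of the walk missed by some [s] in [S] can be bypassed, as the two
    neighbours of [s] at its ends have to be adjacent. *)
Lemma reach_link U S y z : chordal_on U -> S `<=` U -> link S y -> link S z ->
  reach (within (@adj G) (U `\` S)) y z ->
  reach (within (@adj G) (link S)) y z.
Proof.
move=> cU SU Ly Lz [n]; have [m] := ubnP n.
elim: m n y Ly => // m IH [|n] y Ly /=.
  by move=> _ ->; apply: reach_refl.
move=> nm [p [[Uy NSy] [Up NSp] yp]] pz.
case: (pselect (link S p)) => Lp.
  by apply: reach_trans (within1 Ly Lp yp) (IH n _ Lp _ pz).
have [s Ss Nsp] : exists2 s, S s & ~ adj s p.
  apply: contrapT => N; apply: Lp => s Ss; apply: contrapT => Nsp.
  by apply: N; exists s.
pose M := [set x | [/\ U x, ~ S x & ~ adj s x]].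
(* the section of the walk from [p] that [s] misses, and the next vertex *)
have [A [k [q [[AM cA Ap] [a Aa aq] sq [Uq NSq] [kn qz]]]]] :
    exists A k q, [/\ [/\ A `<=` M, conn (@adj G) A & A p],
      exists2 a, A a & adj a q, adj s q, (U `\` S) q &
      k < n /\ walk (within (@adj G) (U `\` S)) k q z].
  have {nm} : M p by [].
  elim: n p {yp Up NSp Lp Nsp} pz => [|n IHn] p /=.
    by move=> -> [_ _ Nsz]; case: Nsz; apply: Lz.
  case=> q [_ [Uq NSq] pq] qz Mp; case: (pselect (adj s q)) => sq.
    exists [set p], n, q; split=> //.
      by split=> [_ ->//| _ _ -> -> |//]; apply: reach_refl.
    by exists p.
  have [A [k [q' [[AM cA Aq] aq' sq' Uq' [kn w]]]]] :=
    IHn _ qz (And3 Uq NSq sq).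
  exists (A `|` [set p]), k, q'; split=> //.
  - split; [by move=> x [/AM|->]| |by right].
    have cq x : (A `|` [set p]) x ->
        reach (within (@adj G) (A `|` [set p])) q x.
      move=> [Ax|->]; first by apply: within_mono (cA _ _ Aq Ax); left.
      by apply: within1; [left|right|apply: adj_sym].
    move=> x x' /cq qx /cq; apply: reach_trans; apply: reach_sym qx.
    exact: adj_in_sym.
  - by case: aq' => a Aa aq'; exists a => //; left.
  - by split=> //; apply: ltnW.
case: (pselect (y = q)) => [E|yq].
  by subst q; apply: (IH k) => //; lia.
apply: (IH k.+1) => //; first by lia.
exists q => //; split=> //; apply: (cU A y q s) => //.
- by move=> x /AM[].
- exact: SU.
- by exists p.
- by exists a => //; apply: adj_sym.
- exact: Ly.
- move=> x /AM[_ NSx Nsx]; split; first by move=> E; subst x.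
  by move/adj_sym.
Qed.

End Simplicial.

(** * Balls in locally chordal graphs *)

Section BallSets.
Variables (G : sgraph).
Implicit Types (u v w x y : G).

(** The open and the closed neighbourhood of radius r/2 are both of this form,
    with radii that differ by at most one. *)
Definition dball n v : set G :=
  [set u | exists2 m, m <= n & walk (@adj G) m u v].

Lemma walk_dist n u v : walk (@adj G) n u v -> exists2 m, m <= n & dist u v m.
Proof.
move=> w; have ex : exists n, `[< walk (@adj G) n u v >].
  by exists n; apply/asboolP.
case: (ex_minnP ex) => m /asboolP wm minm; exists m.
  by apply: minm; apply/asboolP.
by split=> // k /asboolP/minm.
Qed.

Lemma open_nbhdE r v : 0 < r -> open_nbhd r v = dball r.-1./2 v.
Proof.
move=> r0; apply/seteqP; split=> u.
  by move=> [n [w _] nr]; exists n => //; lia.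
by move=> [n nr /walk_dist[m mn d]]; exists m => //; lia.
Qed.

Lemma nbhdE r v : nbhd r v = dball r./2 v.
Proof.
apply/seteqP; split=> u.
  by move=> [n [w _] nr]; exists n => //; lia.
by move=> [n nr /walk_dist[m mn d]]; exists m => //; lia.
Qed.

Lemma dball_mono m n v : m <= n -> dball m v `<=` dball n v.
Proof. by move=> mn u [k km w]; exists k => //; apply: leq_trans mn. Qed.

Lemma dball_center n v : dball n v v.
Proof. by exists 0. Qed.

Lemma dball_adj n v x y : adj x y -> dball n v y -> dball n.+1 v x.
Proof. by move=> xy [m mn w]; exists m.+1 => //; exists y. Qed.

Lemma dball_step n v x : dball n.+1 v x ->
  dball n v x \/ exists2 y, dball n v y & adj x y.
Proof.
move=> [[|m] mn /=]; first by move->; left; apply: dball_center.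
by case=> y xy w; right; exists y => //; exists m.
Qed.

Lemma conn_dball n v : conn (@adj G) (dball n v).
Proof.
suff H m x : m <= n -> walk (@adj G) m x v ->
    reach (within (@adj G) (dball n v)) x v.
  move=> x y [m mn /(H _ _ mn) xv] [k kn /(H _ _ kn) yv].
  by apply: reach_trans xv _; apply: reach_sym yv; apply: adj_in_sym.
elim: m x => [|m IH] x mn /=; first by move->; apply: reach_refl.
move=> [y xy w]; apply: reach_trans (IH _ (ltnW mn) w).
apply: within1 => //; first by exists m.+1 => //; exists y.
by exists m => //; apply: ltnW.
Qed.

Lemma finite_dball n v : locally_finite G -> finite_set (dball n v).
Proof.
move=> fG; elim: n => [|n IH].
  by apply: sub_finite_set (finite_set1 v) => x [[|//] _ /= ->].
apply: (@sub_finite_set _ _ (dball n v `|`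
    \bigcup_(y in dball n v) [set u | adj y u])).
  move=> x /dball_step[|[y By xy]]; first by left.
  by right; exists y => //; apply: adj_sym.
by rewrite finite_setU; split=> //; apply: bigcup_finite.
Qed.

Lemma ball_edge r v x y : open_nbhd r v x -> nbhd r v y -> adj x y ->
  edge (ball r v) x y.
Proof.
move=> [n xn nr] [m ym mr] xy; split=> //.
- by exists n => //; lia.
- by exists m.
- by exists n, m; split=> //; lia.
Qed.

Lemma ball_edge_open r v x y : edge (ball r v) x y ->
  open_nbhd r v x \/ open_nbhd r v y.
Proof.
move=> [_ _ _ [n [m [xn ym nm]]]]; case: (ltnP n.*2 r) => nr.
  by left; exists n.
by right; exists m => //; lia.
Qed.

Lemma open_nbhd_sub r v : open_nbhd r v `<=` nbhd r v.
Proof. by move=> x [n xn nr]; exists n => //; apply: ltnW. Qed.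

(** Edges between two vertices at distance exactly r/2 are missing in a ball,
    so only one such vertex can be added to the open neighbourhood. *)
Lemma locally_chordal_on r v x : locally_chordal G r -> nbhd r v x ->
  chordal_on (open_nbhd r v `|` [set x]).
Proof.
move=> chG Nx; apply: (chordal_chordal_on (chG v)) => y z [Oy|->] [Oz|->] yz.
- exact/ball_edge/yz/open_nbhd_sub.
- exact: ball_edge.
- by apply/edge_sym/ball_edge => //; apply: adj_sym.
- by case: (adj_irr yz).
Qed.

Lemma locally_chordal_star r u : 3 <= r -> locally_chordal G r ->
  chordal_on (dball 1 u).
Proof.
move=> r3 chG; have Nu : nbhd r u u by rewrite nbhdE; apply: dball_center.
apply: chordal_on_sub (locally_chordal_on chG Nu) => x Bx; left.
by rewrite open_nbhdE; [apply: dball_mono Bx|]; lia.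
Qed.

(** Two neighbours of [x] at distance [n.+1] from [v] are joined through the
    ball of radius [n], which does not touch [x]. *)
Lemma sphere_simplicial n v x : chordal_on (dball n.+1 v `|` [set x]) ->
  ~ dball n.+1 v x -> simplicial (dball n.+1 v) x.
Proof.
move=> chG Nx a b [Ba xa] [Bb xb]; have far y : dball n v y -> ~ adj x y.
  by move=> By xy; apply: Nx; apply: dball_adj xy By.
have down y : dball n.+1 v y -> adj x y -> exists2 z, dball n v z & adj y z.
  by move=> /dball_step[By /(far _ By)|].
apply: (chG (dball n v) a b x) => //; try by [left|right].
- by move=> y By; left; apply: dball_mono By.
- exact: conn_dball.
- exact: down.
- exact: down.
move=> y By; split=> [E|yx]; last by apply: (far y) => //; apply: adj_sym.
by subst y; apply: Nx; apply: dball_mono By.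
Qed.

End BallSets.

(** * Local trees of a decomposition into cliques *)

Section CliqueBags.
Variables (G H : sgraph) (V : H -> set G).
Implicit Types (u v w x y : G) (h g : H) (Q U : set G).

Definition holding Q : set H := [set h | Q `<=` V h].
Definition touching U : set H := [set h | exists2 u, U u & V h u].
Definition meeting_edge U h g := adj h g /\ exists2 u, U u & V h u /\ V g u.

Hypothesis V_clique : forall h, clique (V h).
Hypothesis holding_conn : forall Q, clique Q -> Q !=set0 ->
  holding Q !=set0 /\ conn (@adj H) (holding Q).

Lemma clique_pair x y : x = y \/ adj x y -> clique [set x; y].
Proof.
move=> xy a b [->|->] [->|->] ab //; case: xy => xy; try by case: ab.
  exact: xy.
exact: adj_sym.
Qed.

Lemma clique_setU1 Q x : clique Q -> (forall y, Q y -> adj x y) ->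
  clique (Q `|` [set x]).
Proof.
move=> cQ xQ a b [Qa|->] [Qb|->] ab //; first exact: cQ.
- by apply/adj_sym/xQ.
- exact: xQ.
Qed.

Lemma ex_holding x y : x = y \/ adj x y -> exists h, V h x /\ V h y.
Proof.
move=> xy; have [||[h hxy] _] := @holding_conn [set x; y].
- exact: clique_pair.
- by exists x; left.
by exists h; split; apply: hxy; [left|right].
Qed.

Lemma holding_reach Q U h g : clique Q -> U `&` Q !=set0 ->
  holding Q h -> holding Q g -> reach (meeting_edge U) h g.
Proof.
move=> cQ [u [Uu Qu]] Qh Qg; have [|_ /(_ _ _ Qh Qg)] := holding_conn cQ.
  by exists u.
apply: reach_mono => a b [Qa Qb ab]; split=> //.
by exists u => //; split; [apply: Qa|apply: Qb].
Qed.

Lemma meeting_edge_sym U : symm (meeting_edge U).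
Proof. by move=> h g [hg [u Uu [? ?]]]; split; [exact: adj_sym|exists u]. Qed.

Lemma touching_conn U h g : conn (@adj G) U -> touching U h -> touching U g ->
  reach (meeting_edge U) h g.
Proof.
move=> cU [x Ux hx] [y Uy gy]; have [n] := cU _ _ Ux Uy.
elim: n x h Ux hx => [|n IH] x h Ux hx /=.
  move=> E; subst y; apply: (@holding_reach [set x]).
  - by move=> a b -> ->.
  - by exists x.
  - by move=> _ ->.
  - by move=> _ ->.
case=> z [_ Uz xz] zy; have [k [kx kz]] := ex_holding (or_intror xz).
apply: reach_trans (IH z k Uz kz zy); apply: (@holding_reach [set x]).
- by move=> a b -> ->.
- by exists x.
- by move=> _ ->.
- by move=> _ ->.
Qed.

(** All these nodes are linked to a node holding the clique of [Q] and [x]: a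
    node holding [x] and [y] in [Q] among the nodes holding [x] and [y]. *)
Lemma star_conn Q x h g : clique Q -> (forall y, Q y -> adj x y) ->
  touching Q h -> V h x -> touching Q g -> V g x ->
  reach (fun a b => [/\ meeting_edge Q a b, V a x & V b x]) h g.
Proof.
move=> cQ xQ th hx tg gx; have cQx := clique_setU1 cQ xQ.
have [|[k Qk] _] := holding_conn cQx; first by exists x; right.
suff up h' : touching Q h' -> V h' x ->
    reach (fun a b => [/\ meeting_edge Q a b, V a x & V b x]) h' k.
  apply: reach_trans (up h th hx) _; apply: reach_sym (up g tg gx).
  by move=> a b [/meeting_edge_sym].
move=> [y Qy h'y] h'x.
have cyx : clique [set y; x] by apply: clique_pair; right; apply/adj_sym/xQ.
have [|_ C] := holding_conn cyx; first by exists x; right.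
apply: reach_mono (C h' k _ _).
- move=> a b [ya yb ab]; split; [split=> //; exists y => //| |].
  + by split; [apply: ya|apply: yb]; left.
  + by apply: ya; right.
  + by apply: yb; right.
- by move=> _ [->|->].
- by move=> _ [->|->]; apply: Qk; [left|right].
Qed.

Hypothesis V_acyclic : forall u, acyclic (within (@adj H) [set h | V h u]).

(** The trees of the nodes holding a vertex behave like contractible sets whose
    nerve is the clique complex of [U], which is contractible for connected
    chordal [U]. Concretely, [U] arises by successively adding vertices that are
    simplicial at that stage, and each of them glues a tree along a subtree. *)
Lemma meeting_acyclic U : finite_set U -> U !=set0 -> conn (@adj G) U ->
  chordal_on U -> acyclic (meeting_edge U).
Proof.
move=> fU; elim/finite_proper_ind: U / fU => U fU IH U0 cU chU.
have [x Ux sx] := simplicial_exists fU U0 chU.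
pose U' := U `\ x; have U'U : U' `<=` U by move=> y [].
case: (pselect (U' !=set0)) => [U'0|N]; last first.
  apply: acyclic_sub (V_acyclic (u := x)) => h g [hg [u Uu [hu gu]]].
  suff E : u = x by subst u.
  by apply: contrapT => ux; apply: N; exists u.
have cU' : conn (@adj G) U'.
  apply: conn_peel cU U'U _ => y Uy NU'y; suff -> : y = x by [].
  by apply: contrapT => yx; apply: NU'y.
have A' : acyclic (meeting_edge U').
  apply: IH => //; last exact: chordal_on_sub chU.
  by split=> // /(_ _ Ux)[_]; apply.
pose Q := nbrs U x; have QU' : Q `<=` U'.
  by move=> y [Uy xy]; split=> // E; rewrite E in xy; apply: adj_irr xy.
have tQ h : touching U' h -> V h x -> touching Q h.
  move=> [u [Uu ux] hu] hx; exists u => //; split=> //.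
  by apply: (V_clique hx hu); apply/nesym.
apply: acyclic_sub (acyclic_union (e := meeting_edge U')
  (f := within (@adj H) [set h | V h x]) (V := touching U')
  (W := [set h | V h x]) _ _ _ _ _ _ _).
- move=> h g [hg [u Uu [hu gu]]]; case: (pselect (u = x)) => [E|ux].
    by subst u; right.
  by left; split=> //; exists u.
- exact: meeting_edge_sym.
- exact/within_sym/adj_sym.
- exact: A'.
- exact: V_acyclic.
- by move=> h g [_ [u U'u [hu _]]]; exists u.
- by move=> h g [].
move=> h g th hx tg gx.
have := @star_conn Q x h g sx (fun y (Qy : Q y) => Qy.2)
  (tQ _ th hx) hx (tQ _ tg gx) gx.
apply: reach_mono => a b [[ab [u Qu abu]] ax bx]; split=> //.
by split=> //; exists u => //; apply: QU'.
Qed.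

Lemma clique_bags_decompositionP : is_decomposition (full G) (full H) V
  (fun v => induced (full H) [set h | V h v]).
Proof.
have cV v : connected (induced (full H) [set h | V h v]).
  have [||[h vh] C] := @holding_conn [set v].
  - by move=> _ _ -> ->.
  - by exists v.
  split; first by exists h; split=> //; apply: vh.
  move=> a b [_ va] [_ vb].
  apply: reach_mono (C a b _ _) => [k l [vk vl kl]|_ ->|_ ->] //.
  by split=> //; [apply: vk|apply: vl].
split=> // [|v _]; last by split; [split|by []|exact: cV].
apply: subgraph_ext => [|x y].
  apply/seteqP; split=> // x _.
  by have [h [hx _]] := ex_holding (or_introl (erefl x)); exists h.
split=> [xy|[h _ [] //]].
by have [h [hx hy]] := ex_holding (or_intror xy); exists h.
Qed.

Definition clique_decomposition : graph_decomposition G :=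
  GraphDecomposition clique_bags_decompositionP.

Lemma clique_decomposition_local r : locally_finite G -> 3 <= r ->
  locally_chordal G r ->
  locally_induces_tree_decompositions clique_decomposition r.
Proof.
move=> fG r3 chG v; set D := clique_decomposition.
pose O := open_nbhd r v.
have OE : O = dball r.-1./2 v by apply: open_nbhdE; lia.
have NE := nbhdE r v.
have Ov : O v by rewrite OE; apply: dball_center.
have cO : conn (@adj G) O by rewrite OE; apply: conn_dball.
have fO : finite_set O by rewrite OE; apply: finite_dball.
have chO : chordal_on O.
  apply: chordal_on_sub (locally_chordal_on chG (open_nbhd_sub Ov)).
  by left.
have LV : vset (local_graph D r v) = touching O.
  by apply/seteqP; split=> h [u Ou]; [move=> [_ hu]|move=> hu]; exists u.
have LE h g : edge (local_graph D r v) h g <-> meeting_edge O h g.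
  split; first by move=> [u Ou [hg hu gu]]; split=> //; exists u.
  by move=> [hg [u Ou [hu gu]]]; exists u.
have to_open x : nbhd r v x -> exists2 u, O u & u = x \/ adj u x.
  move=> Nx; case: (pselect (O x)) => Ox; first by exists x => //; left.
  move: Nx; rewrite NE => /(dball_mono (_ : _ <= r.-1./2.+1)) [|]; first by lia.
  rewrite -/(dball _ _ _) => m mr wx.
  have /dball_step[|[u]] : dball r.-1./2.+1 v x by exists m.
    by rewrite -OE.
  by rewrite -OE => Ou xu; exists u => //; right; apply: adj_sym.
have sphere x : nbhd r v x -> ~ O x -> simplicial O x.
  move=> Nx; have := locally_chordal_on chG Nx; rewrite -/O OE.
  have -> : r.-1./2 = r.-1./2.-1.+1 by lia.
  exact: sphere_simplicial.
have cx x : nbhd r v x -> connected (induced (local_graph D r v)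
    [set h | @local_bag G D r v h x]).
  move=> Nx; split.
    have [u Ou ux] := to_open x Nx; have [h [hu hx]] := ex_holding ux.
    by exists h; split; [rewrite LV; exists u|split].
  move=> h g [Lh [hx _]] [Lg [gx _]].
  rewrite LV in Lh; rewrite LV in Lg.
  suff : reach (fun a b => [/\ meeting_edge O a b, V a x & V b x]) h g.
    by apply: reach_mono => a b [/LE ? ? ?]; split.
  case: (pselect (O x)) => Ox.
    have [||_ C] := @holding_conn [set x].
    - by move=> _ _ -> ->.
    - by exists x.
    apply: reach_mono (C h g _ _) => [a b [xa xb ab]|_ ->|_ ->] //.
    have [ax bx] : V a x /\ V b x by split; [apply: xa|apply: xb].
    by split=> //; split=> //; exists x.
  have tQ k : touching O k -> V k x -> touching (nbrs O x) k.
    move=> [u Ou ku] kx; exists u => //; split=> //.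
    by apply: (V_clique kx ku) => E; subst u.
  have := @star_conn (nbrs O x) x h g (sphere x Nx Ox)
    (fun y (Qy : nbrs O x y) => Qy.2) (tQ _ Lh hx) hx (tQ _ Lg gx) gx.
  apply: reach_mono => a b [[ab [u [Ou _] abu]] ax bx]; split=> //.
  by split=> //; exists u.
split; first split.
- by move=> h _ x [].
- apply: subgraph_ext => [|x y].
    apply/seteqP; split=> x; last by move=> [h _ []].
    move=> Nx; have [u Ou ux] := to_open x Nx.
    have [h [hu hx]] := ex_holding ux.
    by exists h; [rewrite LV; exists u|split].
  split=> [xy|[h _ []] //]; have [Nx Ny axy _] := xy.
  have [h [hx hy]] := ex_holding (or_intror axy); exists h; last by split.
  by rewrite LV; case: (ball_edge_open xy) => ?; [exists x|exists y].
- exact: cx.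
- move=> x Nx.
  have -> : local_copart D r v x =
      induced (local_graph D r v) [set h | @local_bag G D r v h x].
    rewrite /local_copart; case: asboolP => Ox.
      apply: subgraph_ext => [|h g].
        apply/seteqP; split=> h [Lh hx]; last by split=> //; case: hx.
        by split; [exists x|split].
      split; first by move=> [hg hx gx]; split; [exists x|split|split].
      by move=> [[u _ [hg _ _]] [hx _] [gx _]]; split.
    apply: subgraph_ext => [|h g].
      apply/seteqP; split=> h; first by move=> [[_ hx] Lh]; split.
      by move=> [Lh [hx _]].
    split; first by move=> [[hg hx gx] L]; split.
    by move=> [L [hx _] [gx _]]; split=> //; split=> //; apply: edge_adj L.
  by split; [split|by []|exact: cx].
split.
  split; first by have [h [hv _]] := ex_holding (or_introl (erefl v));
    exists h; rewrite LV; exists v.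
  rewrite LV => h g Lh Lg; apply: reach_mono (touching_conn cO Lh Lg).
  by move=> a b /LE.
apply/acyclicP; apply: acyclic_sub (meeting_acyclic fO _ cO chO).
  by move=> a b /LE.
by exists v.
Qed.

End CliqueBags.

(** * Gluing stars along cliques *)

Section HubGraphs.
Variables (G : sgraph) (N : Type) (V : N -> set G).
Variables (ctr : set G -> N) (hub : set G -> set G -> N).
Implicit Types (h g : N) (S T Q : set G) (c d u x y : G).

Hypothesis fG : locally_finite G.
Hypothesis V_clique : forall h, clique (V h).
Hypothesis ctr_sub : forall S, clique S -> S !=set0 -> S `<=` V (ctr S).
Hypothesis hub_sub : forall S c, clique S -> S !=set0 -> link S c ->
  S `<=` V (hub S (link_comp S c)) /\
  link_comp S c `&` V (hub S (link_comp S c)) !=set0.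
Hypothesis ctr_hub : forall S c, clique S -> S !=set0 -> link S c ->
  V (ctr S) c -> hub S (link_comp S c) = ctr S.
Hypothesis ctr_uniq : forall S h, clique S -> S !=set0 -> V h = S -> h = ctr S.

(** For every nonempty clique [S] a star: its centre is a node holding [S],
    and it has one leaf for each component of the common neighbourhood of [S],
    a node that holds [S] and meets that component. Should the centre itself
    meet a component, then it also takes the place of the leaf. *)
Definition spoke S c h g :=
  [/\ clique S, S !=set0, link S c &
      [/\ h = ctr S, g = hub S (link_comp S c) & h <> g]].

Definition hub_adj h g := exists S c, spoke S c h g \/ spoke S c g h.

Lemma hub_adj_sym h g : hub_adj h g -> hub_adj g h.
Proof. by move=> [S [c [?|?]]]; exists S, c; [right|left]. Qed.

Lemma hub_adj_irr h : ~ hub_adj h h.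
Proof. by move=> [S [c [|] [_ _ _ [_ _ /(_ erefl)]]]]. Qed.

Definition hub_graph : sgraph := SGraph hub_adj_sym hub_adj_irr.

Notation H := hub_graph.
Notation holds := (@holding G H V).

Lemma link_notin S c : link S c -> ~ S c.
Proof. by move=> Lc /Lc /adj_irr. Qed.

Lemma link_clique S c : clique S -> link S c -> clique (S `|` [set c]).
Proof. by move=> cS Lc; apply: clique_setU1 => // y /Lc/adj_sym. Qed.

Lemma link_proper S c : link S c -> S `<` S `|` [set c].
Proof.
by move=> Lc; split; [left|move=> /(_ c (or_intror erefl)); apply: link_notin].
Qed.

Lemma clique_link S Q c : clique Q -> S `<=` Q -> Q c -> ~ S c -> link S c.
Proof.
by move=> cQ SQ Qc NSc s Ss; apply: cQ => //; [exact: SQ|move=> E; subst s].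
Qed.

Lemma spoke_inter S c h g : spoke S c h g -> V h `&` V g = S.
Proof.
move=> [cS S0 Lc [hE gE hg]]; have [Sg [d [cd gd]]] := hub_sub cS S0 Lc.
apply/seteqP; split=> x; last first.
  by move=> Sx; rewrite hE gE; split; [exact: ctr_sub|exact: Sg].
move=> [hx gx]; apply: contrapT => NSx; apply: hg.
rewrite hE in hx; rewrite gE in gx.
have Lx : link S x by apply: clique_link gx NSx.
rewrite hE gE -(ctr_hub cS S0 Lx hx); congr hub; symmetry.
apply: etrans (link_comp_eq cd) _.
exact: clique_link_comp gd gx (link_comp_sub Lc cd) Lx.
Qed.

(** For each edge of a walk from [c] to [d] in the common neighbourhood of [S]
    there is a node holding [S] and that edge. It connects the nodes holding [S]
    and one end of the edge to those holding [S] and the other end. *)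
Lemma link_chain (e : N -> N -> Prop) S c d h g : clique S ->
  (forall T, clique T -> S `<` T -> holds T !=set0 /\
     forall a b, holds T a -> holds T b ->
       reach e a b) ->
  link S c -> link_comp S c d ->
  (S `|` [set c]) `<=` V h -> (S `|` [set d]) `<=` V g -> reach e h g.
Proof.
move=> cS IH Lc [n]; elim: n c h Lc => [|n IHn] c h Lc /=.
  move=> <- hc gc; apply: (IH _ (link_clique cS Lc) (link_proper Lc)).2 => //.
case=> c' [_ Lc' cc'] c'd hc gd.
have cl : clique (S `|` [set c] `|` [set c']).
  apply: clique_setU1 (link_clique cS Lc) _ => y [/Lc'/adj_sym|->] //.
  exact: adj_sym.
have pr : S `<` S `|` [set c] `|` [set c'].
  split; first by do 2!left.
  by move=> sub; apply: (link_notin Lc); apply: sub; left; right.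
have [[k Qk] _] := IH _ cl pr.
apply: reach_trans (IHn c' k Lc' c'd _ gd); last first.
  by move=> x [Sx|->]; apply: Qk; [do 2!left|right].
apply: (IH _ (link_clique cS Lc) (link_proper Lc)).2 => //.
by move=> x xc; apply: Qk; left.
Qed.

Lemma clique_sub_dball Q q : clique Q -> Q q -> Q `<=` dball 1 q.
Proof.
move=> cQ Qq x Qx; case: (pselect (x = q)) => [->|xq].
  exact: dball_center.
by apply: dball_adj (dball_center 0 q); apply: cQ.
Qed.

Lemma hub_holding_conn Q : clique Q -> Q !=set0 ->
  holds Q !=set0 /\ conn (@adj H) (holds Q).
Proof.
move=> cQ [q Qq]; have fM := finite_dball 1 q fG.
have QM := clique_sub_dball cQ Qq; move: Q QM cQ Qq.
apply: (finite_superset_ind fM) => Q _ IH cQ Qq.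
have Q0 : Q !=set0 by exists q.
have cQ' : holds Q (ctr Q) by apply: ctr_sub.
split; first by exists (ctr Q).
have mono T : Q `<=` T -> holds T `<=` holds Q.
  by move=> QT h; apply: subset_trans.
suff to_ctr (h : H) : holds Q h ->
    reach (within (@adj H) (holds Q)) h (ctr Q).
  move=> h g /to_ctr hc /to_ctr gc; apply: reach_trans hc _.
  by apply: reach_sym gc; apply: adj_in_sym.
move=> Qh; case: (pselect (V h `<=` Q)) => [hQ|].
  have -> : h = ctr Q by apply: ctr_uniq => //; apply/seteqP.
  exact: reach_refl.
move=> /existsNP[c /not_implyP[hc NQc]].
have Lc : link Q c by apply: clique_link hc NQc => //; apply: V_clique.
have [Qg [d [cd gd]]] := hub_sub cQ Q0 Lc.
set g := hub Q (link_comp Q c) in Qg gd.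
apply: reach_trans (_ : reach _ h g) _.
  apply: (@link_chain _ Q c d) => //.
  - move=> T cT QT; have [||[k Tk] cT'] := IH T QT _ cT.
    + by apply: clique_sub_dball cT _; case: QT => sub _; apply: sub.
    + by case: QT => sub _; apply: sub.
    split; first by exists k.
    move=> a b Ta Tb; apply: within_mono (cT' a b Ta Tb).
    by apply: mono; case: QT.
  - by move=> x [/Qh|->].
  - by move=> x [/Qg|->].
case: (pselect (ctr Q = g)) => [->|ng]; first exact: reach_refl.
apply: within1 => //; apply: adj_sym; exists Q, c; left; split=> //.
Qed.

(** Nodes that hold [S] and meet the component of the leaf [g] can only be left
    via the spoke: an edge between nodes holding [S] belongs to the star of [S],
    or its ends share a vertex outside [S] and thus meet the same component. *)
Lemma spoke_bridge S c h g : spoke S c h g ->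
  ~ reach (del (within (@adj H) (holds S)) h g) g h.
Proof.
move=> sp; have [cS S0 Lc [hE gE hg]] := sp.
have [Sg cg] := hub_sub cS S0 Lc; rewrite -gE in Sg cg.
pose P k := link_comp S c `&` V k !=set0.
have same x y k : link_comp S c x -> V k x -> V k y -> holds S k ->
    ~ S y -> link_comp S c y.
  move=> cx kx ky Sk NSy; have Ly : link S y by apply: clique_link ky NSy.
  have E := clique_link_comp (@V_clique k) kx ky (link_comp_sub Lc cx) Ly.
  by rewrite (link_comp_eq cx) E; apply: reach_refl.
have NPh : ~ P h.
  move=> [x [cx hx]]; apply: hg; rewrite gE (link_comp_eq cx) hE.
  by rewrite hE in hx; rewrite (ctr_hub cS S0 (link_comp_sub Lc cx) hx).
move=> R; apply: (NPh); apply: (reach_stable (P := P) _ R) => // a b.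
move=> [[Sa Sb ab] n1 n2] [x [cx ax]].
case: ab => T [d sp'].
have TE : V a `&` V b = T by case: sp' => /spoke_inter //; rewrite setIC.
have ST : S `<=` T by rewrite -TE => y Sy; split; [exact: Sa|exact: Sb].
case: (pselect (T `<=` S)) => [TS|/existsNP[y /not_implyP[Ty NSy]]]; last first.
  move: Ty; rewrite -TE => -[ay b_y]; exists y; split=> //.
  exact: same cx ax ay Sa NSy.
have {ST TS} E : T = S by apply/seteqP.
rewrite {}E in sp' TE; case: sp' => -[_ _ Ld [aE bE _]].
  by case: NPh; rewrite hE -aE; exists x.
have [_ [y [dy ay]]] := hub_sub cS S0 Ld; rewrite -bE in ay.
have Ly := link_comp_sub Ld dy.
have cy := same _ _ _ cx ax ay Sa (link_notin Ly).
by case: n2; rewrite hE aE bE gE (link_comp_eq dy) (link_comp_eq cy).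
Qed.

(** On a cycle among the nodes holding [u], choose an edge for which the
    intersection [S] of its bags is inclusion-minimal. The other edges have the
    same intersection, so that their ends hold [S], or their intersections
    contain vertices outside [S]; stretches of the latter give rise to walks
    around [S] and, by chordality, to walks in the common neighbourhood of [S].
    So the cycle yields a detour around a single spoke of the star of [S] among
    the nodes holding [S]. *)
Lemma hub_acyclic u : chordal_on (dball 1 u) ->
  acyclic (within (@adj H) [set h : H | V h u]).
Proof.
move=> chu; set W := [set h : H | V h u].
apply: (@acyclic_sub _ _ (edge (induced (full H) W))).
  by move=> a b [].
apply/acyclicP => n cyc cP; have [n3 cI cE] := cP.
have n0 : 0 < n by lia.
have [i imin] := finite_family_minimal
  (fun i => V (cyc i) `&` V (cyc (ordS i))) (Ordinal n0).
set S := V (cyc i) `&` V (cyc (ordS i)) in imin.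
have [Wi Wi'] : W (cyc i) /\ W (cyc (ordS i)) by have [_ ? ?] := cE i.
have Su : S u by split.
have S0 : S !=set0 by exists u.
have cS : clique S by move=> a b [ia _] [ib _]; apply: V_clique ia ib.
pose e := del (within (@adj H) (holds S)) (cyc i) (cyc (ordS i)).
pose f (a b : H) := [/\ within (@adj H) W a b, ~ V a `&` V b `<` S,
  ~ (a = cyc i /\ b = cyc (ordS i)) & ~ (a = cyc (ordS i) /\ b = cyc i)].
have eS : symm e by apply: del_sym; apply: adj_in_sym.
suff : reach e (cyc (ordS i)) (cyc i).
  have [T [d sp]] : hub_adj (cyc i) (cyc (ordS i)) by case: (cE i).
  have TE : S = T by case: sp => /spoke_inter; rewrite // setIC.
  rewrite -{}TE in sp; case: sp => sp R; apply: (spoke_bridge sp).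
    exact: R.
  apply: reach_mono (reach_sym eS R) => a b [ab n1 n2].
  by split.
have holdS (a b : H) : V a `&` V b = S -> holds S a /\ holds S b.
  by move=> <-; split=> x [].
have outside (a b : H) : f a b -> V a `&` V b <> S ->
    (V a `&` V b) `\` S !=set0.
  move=> [_ Nab _ _] abS; apply: contrapT => N'; apply: abS.
  have sub : V a `&` V b `<=` S.
    by move=> x xab; apply: contrapT => NSx; apply: N'; exists x.
  by apply/seteqP; split=> //; apply: contrapT => NSab; apply: Nab; split.
(* a stretch of the cycle without edges of intersection [S] *)
have stretch k (a b : H) : walk (fun a b => f a b /\ V a `&` V b <> S) k a b ->
    holding (V : H -> _) S a -> holding (V : H -> _) S b -> reach e a b.
  move=> ab Sa Sb; case: k ab => [->|k ab]; first exact: reach_refl.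
  have [p [q [[ap NSp] [bq NSq] pq]]] : exists p q,
      [/\ (V a `\` S) p, (V b `\` S) q &
          reach (within (@adj G) (dball 1 u `\` S)) p q].
    elim: k a {Sa} ab => [|k IH] a [z [az azS] zb];
      have [p [[ap zp] NSp]] := outside _ _ az azS.
      by move: zb => /= E; subst z; exists p, p; split=> //; apply: reach_refl.
    have [p' [q [[zp' NSp'] bq p'q]]] := IH z zb.
    have Bz : V z `<=` dball 1 u.
      by apply: clique_sub_dball (@V_clique z) _; case: az => -[].
    exists p, q; split=> //; apply: reach_trans p'q.
    case: (pselect (p = p')) => [->|pp']; first exact: reach_refl.
    apply: within1; [split=> //; exact: Bz|split=> //; exact: Bz|].
    exact: V_clique zp zp' pp'.
  have Lp : link S p by apply: clique_link ap NSp; [exact: V_clique|].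
  have Lq : link S q by apply: clique_link bq NSq; [exact: V_clique|].
  have SM : S `<=` dball 1 u by apply: clique_sub_dball.
  apply: (@link_chain e S p q) => //.
  - move=> T cT [ST NTS]; have [|Tne Tc] := hub_holding_conn cT.
      by exists u; apply: ST.
    split=> // x y Tx Ty; apply: reach_mono (Tc x y Tx Ty) => k1 k2 [T1 T2 k12].
    split; first by split=> //; apply: subset_trans ST _.
      move=> [E1 E2]; subst k1 k2; apply: NTS => z Tz.
      by split; [exact: T1|exact: T2].
    move=> [E1 E2]; subst k1 k2; apply: NTS => z Tz.
    by split; [exact: T2|exact: T1].
  - exact: reach_link chu SM Lp Lq pq.
  - by move=> x [/Sa|->].
  - by move=> x [/Sb|->].
have detour k (a b : H) : walk f k a b -> holds S a ->
    holds S b -> reach e a b.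
  have [m] := ubnP k; elim: m k a => // m IH k a km ab Sa Sb.
  have [w|[k1 [k2 [a' [b' [w fab /contrapT E w' kk]]]]]] :=
    walk_split (fun a b => V a `&` V b <> S) ab.
    exact: stretch w Sa Sb.
  have [Sa' Sb'] := holdS _ _ E.
  apply: reach_trans (stretch _ _ _ w Sa Sa') _.
  apply: reach_trans (_ : reach e b' b); last by apply: IH w' Sb' Sb; lia.
  by apply: reach1; case: fab => -[_ _ ?] _ ? ?.
have [Si Si'] : holds S (cyc i) /\ holds S (cyc (ordS i)).
  exact: holdS.
apply: (detour n.-1) => //; apply: walk_mono (cycle_walk cyc i) => a b.
move=> [j [ji -> ->]].
have [[ab Wa Wb] n1 n2] := cycle_del cP ji.
by split=> //; exact: imin.
Qed.

Definition hub_decomposition : graph_decomposition G :=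
  clique_decomposition hub_holding_conn.

Lemma hub_decomposition_local r : 3 <= r -> locally_chordal G r ->
  locally_induces_tree_decompositions hub_decomposition r.
Proof.
move=> r3 chG; apply: clique_decomposition_local => // u; apply: hub_acyclic.
exact: locally_chordal_star chG.
Qed.

End HubGraphs.

(** * Decomposition into the maximal cliques *)

Section MaximalCliques.
Variables (G : sgraph) (r : nat).
Hypotheses (fG : locally_finite G) (r3 : 3 <= r) (chG : locally_chordal G r).
Implicit Types (S C Q : set G).

Lemma maximal_clique_ex Q : clique Q ->
  exists K, maximal_clique K /\ Q `<=` K.
Proof.
have base S : clique S -> S !=set0 -> exists K, maximal_clique K /\ S `<=` K.
  move=> cS [s Ss].
  have [||K [[cK SK] _ Kmax]] := @finite_maximal _
    (fun K => clique K /\ S `<=` K) _ S (finite_dball 1 s fG).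
  - by move=> K [cK SK]; apply: clique_sub_dball cK (SK _ Ss).
  - by split.
  exists K; split=> //; split=> // K' cK' KK'; apply: Kmax => //; split=> //.
  exact: subset_trans KK'.
move=> cQ; case: (pselect (Q !=set0)) => [|NQ]; first exact: base.
have Q0 : Q `<=` set0 by move=> x Qx; apply: NQ; exists x.
case: (pselect (exists v : G, True)) => [[v _]|NG].
  have [||K [mK _]] := base [set v]; [by move=> _ _ -> ->|by exists v|].
  by exists K; split=> //; apply: subset_trans Q0 _.
exists Q; split=> //; split=> // K _ _; apply/seteqP.
by split=> x; case: NG; exists x.
Qed.

Definition mclique := {K : set G | maximal_clique K}.

Definition mbag (h : mclique) : set G := sval h.

Lemma mbag_clique h : clique (mbag h).
Proof. by case: (svalP h). Qed.

Lemma mbag_inj : injective mbag.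
Proof. by move=> [S cS] [S' cS']; rewrite /mbag /= => E; exact: eq_exist. Qed.

Lemma mclique_ex Q : clique Q -> exists h, Q `<=` mbag h.
Proof. by case/maximal_clique_ex => K [mK QK]; exists (exist _ K mK). Qed.

(** All choices of hubs are admissible here. As every node is a maximal clique,
    one of the hubs has to double as the centre, unless the clique at hand is
    itself maximal. *)
Lemma maximal_clique_decomposition : exists D : graph_decomposition G,
  into_maximal_cliques D /\ locally_induces_tree_decompositions D r.
Proof.
have /choice[hub hubP] : forall p : set G * set G, exists h : mclique, forall c,
    clique p.1 -> p.1 !=set0 -> link p.1 c -> p.2 = link_comp p.1 c ->
    p.1 `<=` mbag h /\ p.2 `&` mbag h !=set0.
  move=> -[S C] /=.
  case: (pselect (exists c, [/\ clique S, link S c & C = link_comp S c])).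
    move=> [c [cS Lc ->]]; have [h Sh] := mclique_ex (link_clique cS Lc).
    exists h => _ _ _ _ _; split; first by move=> x Sx; apply: Sh; left.
    by exists c; split; [apply: reach_refl|apply: Sh; right].
  have [h _] := @mclique_ex set0 (fun x y (x0 : set0 x) => False_ind _ x0).
  by move=> N; exists h => c cS _ Lc CE; case: N; exists c.
have /choice[ctr ctrP] : forall S, exists k : mclique, clique S -> S !=set0 ->
    [/\ S `<=` mbag k,
      forall c, link S c -> mbag k c -> hub (S, link_comp S c) = k &
      forall h, mbag h = S -> h = k].
  move=> S.
  case: (pselect (clique S /\ S !=set0)) => [[cS S0]|N]; last first.
    have [h _] := @mclique_ex set0 (fun x y (x0 : set0 x) => False_ind _ x0).
    by exists h => cS S0; case: N.
  case: (pselect (exists c, link S c)) => [[c Lc]|NL].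
    have [/= Sh [d [cd hd]]] := hubP (S, link_comp S c) c cS S0 Lc erefl.
    exists (hub (S, link_comp S c)) => _ _; split=> // [c' Lc' hc'|h hE].
      congr (hub (S, _)); apply: etrans (esym (link_comp_eq cd)).
      exact: clique_link_comp (@mbag_clique _) hc' hd Lc' (link_comp_sub Lc cd).
    have [_ hmax] := svalP h; rewrite -/(mbag h) hE in hmax.
    case: (link_notin Lc); rewrite -(hmax _ (link_clique cS Lc)).
      by right.
    by left.
  have [k Sk] := mclique_ex cS; exists k => _ _; split=> // [c Lc|h hE].
    by case: NL; exists c.
  apply: mbag_inj; rewrite hE; apply/seteqP; split=> // x kx.
  apply: contrapT => NSx; apply: NL; exists x.
  exact: clique_link (@mbag_clique k) Sk kx NSx.
pose hub' S C := hub (S, C).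
have h1 S : clique S -> S !=set0 -> S `<=` mbag (ctr S).
  by move=> cS S0; case: (ctrP S cS S0).
have h2 S c : clique S -> S !=set0 -> link S c ->
    S `<=` mbag (hub' S (link_comp S c)) /\
    link_comp S c `&` mbag (hub' S (link_comp S c)) !=set0.
  by move=> cS S0 Lc; apply: (hubP (S, _) c).
have h3 S c : clique S -> S !=set0 -> link S c -> mbag (ctr S) c ->
    hub' S (link_comp S c) = ctr S.
  by move=> cS S0 Lc; case: (ctrP S cS S0) => _ H _; apply: H.
have h4 S h : clique S -> S !=set0 -> mbag h = S -> h = ctr S.
  by move=> cS S0; case: (ctrP S cS S0) => _ _; apply.
exists (hub_decomposition fG mbag_clique h1 h2 h4); split.
  split; first by move=> h _; apply: svalP.
    by move=> h g _ _; apply: mbag_inj.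
  by move=> K mK; exists (exist _ K mK).
exact: hub_decomposition_local.
Qed.

End MaximalCliques.

(** * Canonical decomposition into cliques *)

Section Equivariance.
Variable G : sgraph.
Implicit Types (f g : aut G) (S A : set G) (c x y : G).

Lemma aut_inv f : exists g, cancel f g /\ cancel g f.
Proof.
have [g fK gK] := aut_bij f.
have g_adj x y : adj (g x) (g y) <-> adj x y.
  by rewrite -{2}(gK x) -{2}(gK y) aut_adj.
by exists (Aut (Bijective gK fK) g_adj).
Qed.

Lemma aut_inj f : injective f.
Proof. by have [g [fK _]] := aut_inv f; apply: can_inj fK. Qed.

Lemma image_cancel (T U : Type) (f : T -> U) (g : U -> T) :
  cancel f g -> forall A : set T, g @` (f @` A) = A.
Proof.
move=> fK A; apply/seteqP; split=> [_ [_ [x Ax <-] <-]|x Ax].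
  by rewrite fK.
by exists (f x); [exists x|].
Qed.

(** Equivariance of an operation follows from the inclusion in one direction,
    applied also to the inverse automorphism. *)
Lemma image_equivariant (F : set G -> set G) :
  (forall f S, f @` F S `<=` F (f @` S)) ->
  forall f S, f @` F S = F (f @` S).
Proof.
move=> sub f S; apply/seteqP; split; first exact: sub.
have [g [fK gK]] := aut_inv f; rewrite -[X in X `<=` _](image_cancel gK).
by apply: image_subset; rewrite -[X in _ `<=` F X](image_cancel fK); apply: sub.
Qed.

Lemma image_clique f S : clique S -> clique (f @` S).
Proof.
move=> cS _ _ [x Sx <-] [y Sy <-] xy; apply/aut_adj/cS => // E; apply: xy.
by rewrite E.
Qed.

Lemma image_link f S : f @` link S = link (f @` S).
Proof.
apply: (image_equivariant (F := @link G)) => {}f {}S _ [c Lc <-] _ [s Ss <-].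
by apply/aut_adj/Lc.
Qed.

Lemma image_link_comp f S c :
  f @` link_comp S c = link_comp (f @` S) (f c).
Proof.
have sub (h : aut G) T d : h @` link_comp T d `<=` link_comp (h @` T) (h d).
  move=> _ [x dx <-]; pose P y := link_comp (h @` T) (h d) (h y).
  apply: (reach_stable (P := P) _ dx); last exact: reach_refl.
  move=> a b [La Lb ab] Pa; apply: reach_trans Pa (within1 _ _ _).
  - by rewrite -image_link; exists a.
  - by rewrite -image_link; exists b.
  - exact/aut_adj.
apply/seteqP; split; first exact: sub.
have [g [fK gK]] := aut_inv f.
rewrite -[X in X `<=` _](image_cancel gK).
apply: image_subset; apply: subset_trans (sub g _ _) _.
by rewrite (image_cancel fK) fK.
Qed.

Lemma image_peel f A : f @` peel A = peel (f @` A).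
Proof.
apply: (image_equivariant (F := @peel G)) => {}f {}A _ [x [Ax Nx] <-].
split; first by exists x.
move=> sfx; apply: Nx => a b [Aa xa] [Ab xb] ab; apply/(aut_adj f)/sfx.
- by split; [exists a|apply/aut_adj].
- by split; [exists b|apply/aut_adj].
- by move/aut_inj.
Qed.

Lemma image_core f A : f @` core A = core (f @` A).
Proof.
have it (h : aut G) n B : h @` iter n (@peel G) B = iter n (@peel G) (h @` B).
  by elim: n => //= n IH; rewrite image_peel IH.
apply: (image_equivariant (F := @core G)) => {}f {}A _ [x [n [nx nE]] <-].
by exists n; rewrite -!it nE image_set0; split=> //; exists x.
Qed.

End Equivariance.

Section CanonicalCliques.
Variables (G : sgraph) (r : nat).
Hypotheses (fG : locally_finite G) (r3 : 3 <= r) (chG : locally_chordal G r).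
Implicit Types (S C Q : set G).

Definition cnode := {S : set G | clique S}.

Definition cbag (h : cnode) : set G := sval h.

Lemma cbag_clique h : clique (cbag h).
Proof. exact: svalP. Qed.

Lemma cbag_inj : injective cbag.
Proof. by move=> [S cS] [S' cS']; rewrite /cbag /= => E; exact: eq_exist. Qed.

Lemma clique0 : clique (set0 : set G).
Proof. by move=> x y []. Qed.

Definition cnode_of S : cnode :=
  if pselect (clique S) is left cS then exist _ S cS else exist _ set0 clique0.

Definition chub S C := cnode_of (S `|` core C).

Lemma cnode_ofK S : clique S -> cbag (cnode_of S) = S.
Proof. by rewrite /cnode_of; case: pselect. Qed.

Lemma core_link S c : S !=set0 -> link S c ->
  [/\ core (link_comp S c) `<=` link_comp S c, core (link_comp S c) !=set0 &
      clique (core (link_comp S c))].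
Proof.
move=> [s Ss] Lc; have sub : link_comp S c `<=` dball 1 s.
  move=> d cd; apply: dball_adj (dball_center 0 s).
  exact/adj_sym/(link_comp_sub Lc cd).
apply: core_clique.
- exact: sub_finite_set (finite_dball 1 s fG).
- by exists c; apply: reach_refl.
- exact: conn_link_comp.
- exact: chordal_on_sub sub (locally_chordal_star r3 chG).
Qed.

Lemma chub_bag S c : clique S -> S !=set0 -> link S c ->
  cbag (chub S (link_comp S c)) = S `|` core (link_comp S c).
Proof.
move=> cS S0 Lc; have [sub _ cC] := core_link S0 Lc.
apply: cnode_ofK => x y [Sx|Cx] [Sy|Cy] xy.
- exact: cS.
- exact: (link_comp_sub Lc (sub _ Cy)).
- by apply: adj_sym; apply: (link_comp_sub Lc (sub _ Cx)).
- exact: cC.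
Qed.

Lemma cctr_sub S : clique S -> S !=set0 -> S `<=` cbag (cnode_of S).
Proof. by move=> cS _; rewrite cnode_ofK. Qed.

Lemma chub_sub S c : clique S -> S !=set0 -> link S c ->
  S `<=` cbag (chub S (link_comp S c)) /\
  link_comp S c `&` cbag (chub S (link_comp S c)) !=set0.
Proof.
move=> cS S0 Lc; rewrite chub_bag //; split; first by left.
have [sub [d Cd] _] := core_link S0 Lc.
by exists d; split; [apply: sub|right].
Qed.

Lemma cctr_hub S c : clique S -> S !=set0 -> link S c ->
  cbag (cnode_of S) c -> chub S (link_comp S c) = cnode_of S.
Proof. by move=> cS _ /link_notin NSc; rewrite cnode_ofK. Qed.

Lemma cctr_uniq S h : clique S -> S !=set0 -> cbag h = S -> h = cnode_of S.
Proof. by move=> cS _ hS; apply: cbag_inj; rewrite cnode_ofK. Qed.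

(** With all cliques as nodes, each of them can be its own centre, and its leaf
    for a component of the common neighbourhood is obtained by adding the core
    of that component. So no choices are made, and automorphisms act. *)
Definition canonical_decomposition : graph_decomposition G :=
  hub_decomposition fG cbag_clique cctr_sub chub_sub cctr_uniq.

Definition cact (f : aut G) (h : cnode) : cnode :=
  exist _ (f @` cbag h) (image_clique (@cbag_clique h)).

Lemma cact_bag f h : cbag (cact f h) = f @` cbag h.
Proof. by []. Qed.

Lemma cact_of f S : clique S -> cact f (cnode_of S) = cnode_of (f @` S).
Proof.
move=> cS; apply: cbag_inj; rewrite cnode_ofK; last exact: image_clique.
by rewrite cact_bag cnode_ofK.
Qed.

Lemma cact_can (f g : aut G) : cancel f g -> cancel (cact f) (cact g).
Proof. by move=> fK h; apply: cbag_inj; apply: image_cancel. Qed.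

Lemma cact_spoke (f : aut G) S c h g : spoke cnode_of chub S c h g ->
  spoke cnode_of chub (f @` S) (f c) (cact f h) (cact f g).
Proof.
move=> [cS [s Ss] Lc [-> -> hg]]; split.
- exact: image_clique.
- by exists (f s); exists s.
- by rewrite -image_link; exists c.
have S0 : S !=set0 by exists s.
have E : chub (f @` S) (link_comp (f @` S) (f c)) =
    cact f (chub S (link_comp S c)).
  apply: cbag_inj; rewrite cact_bag (chub_bag cS S0 Lc).
  rewrite image_setU image_core image_link_comp chub_bag //.
  - exact: image_clique.
  - by exists (f s); exists s.
  - by rewrite -image_link; exists c.
rewrite E cact_of //; split=> // F; apply: hg.
have [f' [fK _]] := aut_inv f; apply: can_inj (cact_can fK) _ _ _.
by rewrite cact_of.
Qed.

Lemma cact_adj f (h g : dgraph canonical_decomposition) :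
  adj (cact f h : dgraph canonical_decomposition) (cact f g) <-> adj h g.
Proof.
have H f' (h' g' : cnode) : hub_adj cnode_of chub h' g' ->
    hub_adj cnode_of chub (cact f' h') (cact f' g').
  move=> [S [c sp]]; exists (f' @` S), (f' c).
  by case: sp => /(cact_spoke f'); [left|right].
split; last exact: H.
have [f' [fK _]] := aut_inv f => /(H f').
by rewrite !(cact_can fK).
Qed.

Lemma cact_bij f : bijective (cact f).
Proof.
by have [g [fK gK]] := aut_inv f; exists (cact g); apply: cact_can.
Qed.

Definition caut f : aut (dgraph canonical_decomposition) :=
  @Aut (dgraph canonical_decomposition) _ (cact_bij f) (cact_adj f).

Lemma canonical_decompositionP : is_canonical canonical_decomposition.
Proof.
exists caut; split.
- by move=> h; apply: cbag_inj; rewrite /cbag /= image_id.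
- by move=> f g h; apply: cbag_inj; rewrite /cbag /= image_comp.
- by [].
move=> f v; have act_bag h : cbag (cact f h) (f v) <-> cbag h v.
  by split=> [[x hx /aut_inj <-]|hv] //; exists v.
apply: subgraph_ext => [|h g].
  apply/seteqP; split=> h.
    by move=> [h' [_ hv] <-]; split=> //; apply/act_bag.
  move=> [_ hv]; have [f' _ f'K] := cact_bij f.
  exists (f' h); last exact: f'K.
  by split=> //; apply/act_bag; rewrite f'K.
split.
  move=> [h' [g' [[hg hv gv] <- <-]]].
  by split; [apply/aut_adj|apply/act_bag|apply/act_bag].
move=> [hg hv gv]; have [f' _ f'K] := cact_bij f.
exists (f' h), (f' g); split; [split|exact: f'K|exact: f'K].
- by apply/(cact_adj f); rewrite !f'K.
- by apply/act_bag; rewrite f'K.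
- by apply/act_bag; rewrite f'K.
Qed.

Lemma canonical_clique_decomposition : exists D : graph_decomposition G,
  [/\ is_canonical D, into_cliques D &
      locally_induces_tree_decompositions D r].
Proof.
exists canonical_decomposition; split.
- exact: canonical_decompositionP.
- exact: cbag_clique.
- by apply: hub_decomposition_local => //; apply: cctr_hub.
Qed.

End CanonicalCliques.

(** * Locally induced tree-decompositions force local chordality *)

Lemma conn_bigcup (J T : Type) (k : J -> J -> Prop) (A : set J)
    (e : T -> T -> Prop) (F : J -> set T) :
  conn k A -> (forall j, A j -> conn e (F j)) ->
  (forall i j, within k A i j -> F i `&` F j !=set0) ->
  conn e (\bigcup_(j in A) F j).
Proof.
move=> cA cF meet x y [i Ai Fx] [j Aj Fy]; have [n] := cA _ _ Ai Aj.
elim: n i x Ai Fx => [|n IH] i x Ai Fx /=.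
  move=> E; subst j; apply: within_mono (cF _ Ai _ _ Fx Fy) => z Fz.
  by exists i.
case=> i' ii' w; have [z [Fz F'z]] := meet _ _ ii'; case: ii' => _ Ai' _.
apply: reach_trans (IH i' z Ai' F'z w).
by apply: within_mono (cF _ Ai _ _ Fx Fz) => t Ft; exists i.
Qed.

Section LocallyInducedTrees.
Variables (G : sgraph) (r : nat) (D : graph_decomposition G).
Hypotheses (r3 : 3 <= r) (D_clique : into_cliques D).
Hypothesis D_trees : locally_induces_tree_decompositions D r.
Variable v : G.

Let L := local_graph D r v.
Let F x : set (dgraph D) := [set h | vset L h /\ local_bag r v h x].

Lemma local_tree_acyclic : acyclic (edge L).
Proof. by apply/acyclicP; case: (D_trees v) => _ []. Qed.

Lemma local_subtree_conn x : nbhd r v x -> conn (edge L) (F x).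
Proof.
move=> Nx h g Fh Fg; have [[_ _ cF _] _] := D_trees v.
have [_ /(_ h g Fh Fg)] := cF _ Nx.
apply: reach_mono => a b [ab ax bx]; split=> //; split=> //.
  exact: edge_vset ab.
exact: edge_vset (edge_sym ab).
Qed.

Lemma edge_share x y : edge (ball r v) x y -> F x `&` F y !=set0.
Proof.
have [[_ E _ _] _] := D_trees v; rewrite {1}E => -[h Lh [_ hx hy]].
by exists h.
Qed.

Lemma share_edge x y : open_nbhd r v x -> x <> y -> F x `&` F y !=set0 ->
  edge (ball r v) x y.
Proof.
move=> Ox xy [h [[_ [hx _]] [_ [hy Ny]]]]; apply: ball_edge => //.
exact: D_clique hx hy xy.
Qed.

(** For neighbours [a], [b] of a vertex [s] at distance r/2 from [v], the trees
    of [a], [s], [b] and the union of the trees of the vertices closer to [v]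
    than [a] and [b] meet cyclically. As [s] is not adjacent to any of those
    vertices, its tree is disjoint from the union; so the other two trees meet. *)
Lemma sphere_neighbours_adj s a b : nbhd r v s -> ~ open_nbhd r v s ->
  edge (ball r v) s a -> edge (ball r v) s b -> a <> b ->
  edge (ball r v) a b.
Proof.
move=> Ns NOs sa sb ab.
have [Oa Ob] : open_nbhd r v a /\ open_nbhd r v b.
  by split; [case: (ball_edge_open sa)|case: (ball_edge_open sb)].
pose n := r.-1./2.-1.
have OE : open_nbhd r v = dball n.+1 v.
  by rewrite open_nbhdE; [congr dball; rewrite /n|]; lia.
have up y : dball n v y -> open_nbhd r v y by rewrite OE; apply: dball_mono.
have far y : dball n v y -> ~ adj s y.
  by move=> By sy; apply: NOs; rewrite OE; apply: dball_adj By.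
have nb y : open_nbhd r v y -> nbhd r v y by apply: open_nbhd_sub.
pose U := \bigcup_(w in dball n v) F w.
have cU : conn (edge L) U.
  apply: conn_bigcup (@conn_dball G n v) _ _ => [w Bw|w w' [Bw Bw' ww']].
    exact/local_subtree_conn/nb/up.
  by apply: edge_share; apply: ball_edge => //; [apply: up|apply/nb/up].
have Umeet y : open_nbhd r v y -> adj s y -> U `&` F y !=set0.
  rewrite {1}OE => By sy; have [/far//|[w Bw yw]] := dball_step By.
  have [|h [hy hw]] := @edge_share y w.
    by apply: ball_edge => //; [rewrite OE|apply/nb/up].
  by exists h; split=> //; exists w.
have [||||||||H|[h [hs [w Bw hw]]]] := four_subtrees (A := F a) (B := F s)
  (C := F b) (D := U) (@edge_sym _ L) local_tree_acyclic.
- exact/local_subtree_conn/nb.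
- exact: local_subtree_conn.
- exact/local_subtree_conn/nb.
- exact: cU.
- exact/edge_share/edge_sym.
- exact: edge_share.
- by have [h [? ?]] := Umeet b Ob (edge_adj sb); exists h.
- exact: Umeet (edge_adj sa).
- exact: share_edge.
case: (far w Bw); apply/adj_sym/edge_adj; apply: (@share_edge w s).
- exact: up.
- by move=> E; subst w; apply/NOs/up.
- by exists h.
Qed.

(** A cycle through a vertex at distance r/2 has a chord between the neighbours
    of that vertex. Otherwise the trees of the first three vertices of the cycle
    and the union of the trees of the remaining ones meet cyclically. *)
Lemma chordal_ball : chordal (ball r v).
Proof.
move=> n c n4 cP; have [n3 cI cE] := cP.
have cN i : nbhd r v (c i) by apply: edge_vset (cE i).
have nS (i j : 'I_n) : j <> ordS i <->
    j <> (if i.+1 == n then 0 else i.+1) :> nat.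
  by rewrite -val_ordS; split=> ji E; apply: ji; [apply: ord_inj|rewrite E].
case: (pselect (exists i, ~ open_nbhd r v (c i))) => [[i Ni]|allO].
  have iN := ltn_ord i; pose k : 'I_n := ord_pred i.
  have kE : k = (if i == 0 :> nat then n.-1 else i.-1) :> nat.
    rewrite /= /k /=; case: eqP => [->|i0].
      by rewrite add0n modn_small //; lia.
    have -> : (i + n).-1 = i.-1 + n by lia.
    by rewrite modnDr modn_small //; lia.
  have ki : ordS k = i by apply: ord_predK.
  have kj : k <> ordS i.
    by apply/nS; rewrite kE; do 2!case: eqP; lia.
  exists k, (ordS i); split.
  - apply: sphere_neighbours_adj (cN i) Ni _ (cE i) _ => [|/cI//].
    by have := cE k; rewrite ki => /edge_sym.
  - apply/nS; rewrite val_ordS kE; do ![case: eqP]; lia.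
  - apply/nS; rewrite val_ordS kE; do ![case: eqP]; lia.
have cO i : open_nbhd r v (c i) by apply: contrapT => N; apply: allO; exists i.
have [n0 n1 n2 n3'] : [/\ 0 < n, 1 < n, 2 < n & 3 < n] by split; lia.
pose i0 := Ordinal n0; pose i1 := Ordinal n1; pose i2 := Ordinal n2.
have next (i j : 'I_n) : j = (if i.+1 == n then 0 else i.+1) :> nat ->
    F (c i) `&` F (c j) !=set0.
  rewrite -val_ordS => /ord_inj->; exact: edge_share.
pose A : set 'I_n := [set j | 3 <= j].
pose k (i j : 'I_n) := j = ordS i \/ i = ordS j.
have kS : symm k by move=> i j [?|?]; [right|left].
have cA : conn k A.
  suff up m (j : 'I_n) : j = m + 3 :> nat -> reach (within k A) (Ordinal n3') j.
    move=> i j Ai Aj.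
    apply: reach_trans (reach_sym (within_sym kS) (up (i - 3) i _)) _.
      by rewrite /A /= in Ai; lia.
    by apply: (up (j - 3)); rewrite /A /= in Aj; lia.
  elim: m j => [|m IH] j jm.
    suff -> : j = Ordinal n3' by apply: reach_refl.
    by apply: ord_inj; rewrite jm.
  have jn := ltn_ord j; have mn : m + 3 < n by lia.
  apply: reach_trans (IH (Ordinal mn) erefl) _; apply: reach1; split.
  - by rewrite /A /=; lia.
  - by rewrite /A /=; lia.
  - by left; apply: ord_inj; rewrite val_ordS /=; case: eqP; lia.
have cF i : conn (edge L) (F (c i)) by apply: local_subtree_conn.
pose U := \bigcup_(j in A) F (c j).
have cU : conn (edge L) U.
  apply: (conn_bigcup cA) => // i j [_ _ [->|->]]; first exact: edge_share.
  exact/edge_share/edge_sym.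
have m2U : F (c i2) `&` U !=set0.
  have [|h [? ?]] := next i2 (Ordinal n3'); first by rewrite /=; case: eqP; lia.
  by exists h; split=> //; exists (Ordinal n3').
have m01 : F (c i0) `&` F (c i1) !=set0.
  by apply: next => /=; case: eqP; lia.
have m12 : F (c i1) `&` F (c i2) !=set0.
  by apply: next => /=; case: eqP; lia.
have nl : n.-1 < n by lia.
have mU0 : U `&` F (c i0) !=set0.
  have [|h [? ?]] := next (Ordinal nl) i0; first by rewrite /=; case: eqP; lia.
  by exists h; split=> //; exists (Ordinal nl) => //; rewrite /A /=; lia.
have dist_c (i j : 'I_n) : i <> j :> nat -> c i <> c j.
  by move=> ij /cI E; apply: ij; rewrite E.
have [h02|[h [h1 [j Aj hj]]]] := four_subtrees (@edge_sym _ L)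
  local_tree_acyclic (cF i0) (cF i1) (cF i2) cU m01 m12 m2U mU0.
  exists i0, i2; split.
  - by apply: share_edge => //; apply: dist_c.
  - by apply/nS => /=; case: eqP; lia.
  - by apply/nS => /=; case: eqP; lia.
have jn := ltn_ord j; rewrite /A /= in Aj; exists i1, j; split.
- by apply: share_edge => //; [apply: dist_c => /=; lia|exists h].
- by apply/nS => /=; case: eqP; lia.
- by apply/nS => /=; case: eqP; lia.
Qed.

End LocallyInducedTrees.

(** * The equivalence *)

Theorem theorem6 (G : sgraph) (r : nat)
    (hG : locally_finite G) (hr : 3 <= r) :
  [<-> locally_chordal G r;
       exists D : graph_decomposition G,
         into_maximal_cliques D /\ locally_induces_tree_decompositions D r;
       exists D : graph_decomposition G,
         [/\ is_canonical D, into_cliques D &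
             locally_induces_tree_decompositions D r];
       exists D : graph_decomposition G,
         into_cliques D /\ locally_induces_tree_decompositions D r].
Proof.
have chordal_of (D : graph_decomposition G) : into_cliques D ->
    locally_induces_tree_decompositions D r -> locally_chordal G r.
  by move=> cD tD v; apply: chordal_ball hr cD tD v.
tfae.
- exact: maximal_clique_decomposition.
- move=> [D [[mD _ _] tD]]; apply: canonical_clique_decomposition => //.
  by apply: chordal_of tD => h; have [] := mD h I.
- by move=> [D [_ cD tD]]; exists D.
- by move=> [D [cD tD]]; apply: chordal_of tD.
Qed.
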